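(* Let $X$ and $Y$ be real Banach spaces. Then the following hold. (1) $X\oplus_1Y$ has weakly average non rough norm if and only if both $X$ and $Y$ have weakly average non rough norm; likewise, $X\oplus_1Y$ has non rough norm if and only if both $X$ and $Y$ have non rough norm. (2) For $1<p\leq\infty$, $X\oplus_pY$ has weakly average non rough norm if and only if $X$ or $Y$ has weakly average non rough norm; likewise, $X\oplus_pY$ has non rough norm if and only if $X$ or $Y$ has non rough norm. (3) If $X\oplus_1Y$ has average non rough norm, then both $X$ and $Y$ have average non rough norm. (4) If $X$ or $Y$ has average non rough norm, then $X\oplus_pY$ has average non rough norm for every $1<p\leq\infty$. (5) $X\oplus_\infty Y$ has average non rough norm if and only if $X$ or $Y$ has average non rough norm.
   Context: All Banach spaces are real. $B_{Z}$ denotes the closed unit ball of $Z$. $X\oplus_pY$ is $X\times Y$ with norm $\|(x,y)\|=(\|x\|^p+\|y\|^p)^{1/p}$ for $1\le p<\infty$ and $\|(x,y)\|=\max\{\|x\|,\|y\|\}$ for $p=\infty$. For a Banach space $Z$, a $w^*$-slice of $B_{Z^*}$ is a set $S(B_{Z^*},z,\alpha)=\{z^*\in B_{Z^*}: z^*(z)>\sup_{y^*\in B_{Z^*}}y^*(z)-\alpha\}$ with $z\in Z$, $\alpha>0$. A convex combination of sets $S_1,\dots,S_n$ is $\sum_{i=1}^n\lambda_iS_i$ (Minkowski sum) with $\lambda_i>0$, $\sum_i\lambda_i=1$. For $\varepsilon>0$, the norm of $Z$ is: $\varepsilon$-rough if every $w^*$-slice of $B_{Z^*}$ has diameter $\geq\varepsilon$;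 weakly $\varepsilon$-average rough if every nonempty relatively $w^*$-open subset of $B_{Z^*}$ has diameter $\geq\varepsilon$; $\varepsilon$-average rough if every convex combination of $w^*$-slices of $B_{Z^*}$ has diameter $\geq\varepsilon$. The norm of $Z$ is non rough (resp. weakly average non rough, average non rough) if for no $\varepsilon>0$ is it $\varepsilon$-rough (resp. weakly $\varepsilon$-average rough, $\varepsilon$-average rough).
   Formalization: In (2), (4) and (5) X and Y are assumed nonzero: for X = {0} and Y with rough norm (e.g. ℓ_1), X is non rough in all senses while X⊕_pY = Y is rough, so these clauses fail as stated. *)

(* Defs.v *)
From HB Require Import structures.
From mathcomp Require Import all_boot all_order all_algebra.
From mathcomp Require Import ring.
From mathcomp Require Import all_classical all_reals all_analysis.
Set Implicit Arguments.
Unset Strict Implicit.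
Unset Printing Implicit Defensive.
Import Order.TTheory GRing.Theory Num.Theory.
Import numFieldNormedType.Exports.
Local Open Scope classical_set_scope.
Local Open Scope ring_scope.

(** The carrier of [X \oplus_p Y]. It takes a proof of [1 <= p] because the
    formula below is not a norm for other [p]; without the alias, [X * Y] would
    get the max norm of the library. *)
Definition psum (R : realType) (p : \bar R) (p1 : (1 <= p)%E)
  (X Y : normedModType R) : Type := (X * Y)%type.

Definition psum_norm (R : realType) (p : \bar R) (X Y : normedModType R)
    (u : X * Y) : R :=
  match p with
  | r%:E => (`|u.1| `^ r + `|u.2| `^ r) `^ r^-1
  | +oo%E => Num.max `|u.1| `|u.2|
  | -oo%E => 0
  end.

Section pnorm2.
Context {R : realType}.

Lemma pnorm2_homo (r a b c d : R) : 1 <= r -> 0 <= a -> 0 <= b ->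
  a <= c -> b <= d -> (a `^ r + b `^ r) `^ r^-1 <= (c `^ r + d `^ r) `^ r^-1.
Proof.
move=> r1 a0 b0 ac bd; have r0 : 0 <= r by apply: le_trans r1.
rewrite ge0_ler_powR ?invr_ge0// ?nnegrE ?addr_ge0 ?powR_ge0//.
by rewrite lerD// ge0_ler_powR// nnegrE ?(le_trans _ ac) ?(le_trans _ bd).
Qed.

Lemma pnorm2_eq0 (r a b : R) : 1 <= r -> 0 <= a -> 0 <= b ->
  (a `^ r + b `^ r) `^ r^-1 = 0 -> a = 0 /\ b = 0.
Proof.
move=> r1 a0 b0 /eqP; have r0 : 0 < r by apply: lt_le_trans r1.
rewrite powR_eq0 invr_eq0 (gt_eqF r0) andbT paddr_eq0 ?powR_ge0//.
by rewrite !powR_eq0 => /andP[/andP[/eqP -> _] /andP[/eqP -> _]].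
Qed.

Lemma pnorm2_scale (r l a b : R) : 1 <= r -> 0 <= l -> 0 <= a -> 0 <= b ->
  ((l * a) `^ r + (l * b) `^ r) `^ r^-1 = l * (a `^ r + b `^ r) `^ r^-1.
Proof.
move=> r1 l0 a0 b0; have r0 : 0 < r by apply: lt_le_trans r1.
rewrite !powRM// -mulrDr powRM ?powR_ge0 ?addr_ge0 ?powR_ge0//.
by rewrite -powRrM mulfV ?gt_eqF// powRr1.
Qed.

Lemma pnorm2_triangle (r a b c d : R) : 1 <= r ->
  0 <= a -> 0 <= b -> 0 <= c -> 0 <= d ->
  ((a + c) `^ r + (b + d) `^ r) `^ r^-1 <=
  (a `^ r + b `^ r) `^ r^-1 + (c `^ r + d `^ r) `^ r^-1.
Proof.
move=> r1 a0 b0 c0 d0; have r0 : 0 < r by apply: lt_le_trans r1.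
move sE : ((a `^ r + b `^ r) `^ r^-1) => s.
move tE : ((c `^ r + d `^ r) `^ r^-1) => t.
have [s0|s0] := eqVneq s 0.
  have [a_0 b_0] := pnorm2_eq0 r1 a0 b0 (etrans sE s0).
  by rewrite s0 a_0 b_0 !add0r tE.
have [t0|t0] := eqVneq t 0.
  have [c_0 d_0] := pnorm2_eq0 r1 c0 d0 (etrans tE t0).
  by rewrite t0 c_0 d_0 !addr0 sE.
have {}s0 : 0 < s by rewrite lt_neqAle eq_sym s0 -sE powR_ge0.
have {}t0 : 0 < t by rewrite lt_neqAle eq_sym t0 -tE powR_ge0.
have st0 : 0 < s + t by exact: addr_gt0.
have w0 : 0 <= s / (s + t) by rewrite divr_ge0 ?ltW.
have w1 : s / (s + t) <= 1 by rewrite ler_pdivrMr// mul1r lerDl ltW.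
pose w := Itv01 w0 w1.
have wE : 1 - s / (s + t) = t / (s + t).
  rewrite -[X in X - _](divff (lt0r_neq0 st0)) -mulrBl.
  by rewrite addrAC subrr add0r.
have cvx (x y : R) : 0 <= x -> 0 <= y ->
    ((x + y) / (s + t)) `^ r <=
    s / (s + t) * (x / s) `^ r + t / (s + t) * (y / t) `^ r.
  move=> x0 y0; have xs : 0 <= x / s by rewrite divr_ge0 ?(ltW s0).
  have yt : 0 <= y / t by rewrite divr_ge0 ?(ltW t0).
  have mem (z : R) : 0 <= z -> z \in (`[0, +oo[%classic : set R).
    by move=> z0; rewrite inE/= in_itv/= z0.
  have wtE : unstable.onem w%:inum = t / (s + t) by rewrite -wE.
  have <- : conv w (x / s : R^o) (y / t : R^o) = (x + y) / (s + t).
    rewrite convRE wtE /=; field.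
    by rewrite !gt_eqF.
  apply: le_trans (convex_powR r1 w (mem _ xs) (mem _ yt)) _.
  by rewrite convRE wtE.
have unit (x y u : R) : 0 <= x -> 0 <= y ->
    u = (x `^ r + y `^ r) `^ r^-1 -> 0 < u ->
    (x / u) `^ r + (y / u) `^ r = 1.
  move=> x0 y0 uE u0; rewrite !powRM ?invr_ge0 ?(ltW u0)// -mulrDl.
  have -> : x `^ r + y `^ r = u `^ r.
    rewrite uE -powRrM mulVf ?gt_eqF// powRr1//.
    by rewrite addr_ge0 ?powR_ge0.
  by rewrite -powRM ?invr_ge0 ?(ltW u0)// mulfV ?gt_eqF// powR1.
rewrite -[leRHS]mul1r -ler_pdivrMr//.
have -> : ((a + c) `^ r + (b + d) `^ r) `^ r^-1 / (s + t) =
    (((a + c) / (s + t)) `^ r + ((b + d) / (s + t)) `^ r) `^ r^-1.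
  rewrite -!(mulrC (s + t)^-1) pnorm2_scale ?invr_ge0 ?(ltW st0)//.
    exact: addr_ge0.
  exact: addr_ge0.
have one : (1 : R) `^ r^-1 = 1 by rewrite powR1.
rewrite -[leRHS]one ge0_ler_powR ?invr_ge0 ?(ltW r0)//
  ?nnegrE ?addr_ge0 ?powR_ge0//.
apply: (le_trans (lerD (cvx _ _ a0 c0) (cvx _ _ b0 d0))).
rewrite addrACA -!mulrDr (unit a b s)// (unit c d t)// !mulr1 -mulrDl.
by rewrite divff// gt_eqF.
Qed.

End pnorm2.

Section psum_normed.
Context {R : realType} (p : \bar R) (p1 : (1 <= p)%E).

Section normed.
Variables X Y : normedModType R.
Local Notation N := (@psum_norm R p X Y).

Lemma psum_ler_normD (u v : X * Y) : N (u + v) <= N u + N v.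
Proof.
rewrite /psum_norm; case: p p1 => [r|//|]; rewrite ?lee_fin => r1.
- have := pnorm2_triangle r1 (normr_ge0 u.1) (normr_ge0 u.2)
    (normr_ge0 v.1) (normr_ge0 v.2).
  apply: le_trans; by apply: pnorm2_homo => //; exact: ler_normD.
- rewrite ge_max; apply/andP; split; apply: (le_trans (ler_normD _ _));
  by rewrite lerD// le_max lexx ?orbT.
- by rewrite addr0.
Qed.

Lemma psum_normrZ (l : R) (u : X * Y) : N (l *: u) = `|l| * N u.
Proof.
rewrite /psum_norm; case: p p1 => [r|//|]; rewrite ?lee_fin => r1 /=.
- by rewrite !normrZ pnorm2_scale.
- by rewrite !normrZ maxr_pMr.
- by rewrite mulr0.
Qed.

Lemma psum_norm_eq0 (u : X * Y) : N u = 0 -> u = 0.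
Proof.
case: u => x y; rewrite /psum_norm.
case: p p1 => [r|//|//]; rewrite ?lee_fin /=.
- by move=> r1 /pnorm2_eq0[]// /normr0_eq0 -> /normr0_eq0 ->.
- move=> _ m0; have : `|x| <= 0 /\ `|y| <= 0.
    by rewrite -m0 !le_max !lexx ?orbT.
  by rewrite !normr_le0 => -[/eqP -> /eqP ->].
Qed.

HB.instance Definition _ := Choice.copy (psum p1 X Y) (X * Y)%type.
HB.instance Definition _ := GRing.Lmodule.copy (psum p1 X Y) (X * Y)%type.
HB.instance Definition _ := @Lmodule_isNormed.Build R (psum p1 X Y)
  N psum_ler_normD psum_normrZ psum_norm_eq0.

Lemma psum_normE (u : psum p1 X Y) : `|u| = psum_norm p u.
Proof. by []. Qed.

Lemma psum_norm_ge (u : psum p1 X Y) : `|u.1| <= `|u| /\ `|u.2| <= `|u|.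
Proof.
rewrite psum_normE /psum_norm; case: p p1 => [r|_|//]; last first.
  by rewrite !le_max !lexx orbT.
rewrite lee_fin => r1; have r0 : 0 < r by apply: lt_le_trans r1.
have powK (x : R) : 0 <= x -> x = (x `^ r) `^ r^-1.
  by move=> x0; rewrite -powRrM mulfV ?gt_eqF// powRr1.
split; rewrite [leLHS]powK// ge0_ler_powR ?invr_ge0 ?(ltW r0)//
  ?nnegrE ?addr_ge0 ?powR_ge0//.
  by rewrite lerDl powR_ge0.
by rewrite lerDr powR_ge0.
Qed.

Lemma psum_norm_le (u : psum p1 X Y) : `|u| <= `|u.1| + `|u.2|.
Proof.
rewrite psum_normE /psum_norm; case: p p1 => [r|_|//]; rewrite ?lee_fin.
  move=> r1; have r0 : 0 < r by apply: lt_le_trans r1.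
  have := @pnorm2_triangle R r `|u.1| 0 0 `|u.2| r1.
  rewrite !addr0 !add0r powR0 ?gt_eqF// !addr0 !add0r.
  by rewrite -!powRrM !mulfV ?gt_eqF// !powRr1//; exact.
by rewrite ge_max lerDl lerDr !normr_ge0.
Qed.

End normed.

Section complete.
Variables X Y : completeNormedModType R.

Lemma psum_complete (F : set_system (psum p1 X Y)) :
  ProperFilter F -> cauchy F -> cvg F.
Proof.
move=> FF /cauchyP Fc.
have Fc1 : cauchy ((fun v : psum p1 X Y => v.1) @ F).
  apply: cauchy_exP => e /Fc[u Fu]; exists u.1.
  suff: F [set v | ball u.1 e v.1] by [].
  apply: filterS Fu => v; rewrite -!ball_normE /= => uv.
  by apply: le_lt_trans uv; have [] := psum_norm_ge (u - v).
have Fc2 : cauchy ((fun v : psum p1 X Y => v.2) @ F).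
  apply: cauchy_exP => e /Fc[u Fu]; exists u.2.
  suff: F [set v | ball u.2 e v.2] by [].
  apply: filterS Fu => v; rewrite -!ball_normE /= => uv.
  by apply: le_lt_trans uv; have [] := psum_norm_ge (u - v).
have [x Fx] : exists x : X, (fun v : psum p1 X Y => v.1) @ F --> x.
  by apply/cvg_ex; apply: cauchy_cvg.
have [y Fy] : exists y : Y, (fun v : psum p1 X Y => v.2) @ F --> y.
  by apply/cvg_ex; apply: cauchy_cvg.
apply/cvg_ex; exists ((x, y) : psum p1 X Y).
apply/cvgrPdist_lt => /= e e0.
have e20 : 0 < e / 2 by rewrite divr_gt0.
move/cvgrPdist_lt : Fx => /(_ _ e20) Fx.
move/cvgrPdist_lt : Fy => /(_ _ e20) Fy.
near=> u; rewrite [e]splitr; apply: (le_lt_trans (psum_norm_le _)).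
apply: ltrD.
  by near: u; exact: Fx.
by near: u; exact: Fy.
Unshelve. all: by end_near. Qed.

HB.instance Definition _ :=
  Uniform_isComplete.Build (psum p1 X Y) psum_complete.

End complete.
End psum_normed.

Section roughness.
Context {R : realType} (Z : normedModType R).
Implicit Types (f g h : Z -> R^o) (S W : set (Z -> R^o)).

(** The dual [Z^*], as a set of functions with the pointwise operations. *)
Definition continuous_dual : set (Z -> R^o) :=
  [set f | linear f /\ continuous f].

(** Meaningful for [f] in [continuous_dual]: the set is then bounded. *)
Definition dual_norm f : R := sup [set `|f z| | z in [set z | `|z| <= 1]].

Definition dual_ball : set (Z -> R^o) :=
  [set f | continuous_dual f /\ dual_norm f <= 1].

Definition diam S : \bar R :=
  ereal_sup [set (dual_norm (f - g))%:E | f in S & g in S].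

Definition wstar_slice (z : Z) (a : R) : set (Z -> R^o) :=
  [set f | dual_ball f /\ sup [set g z | g in dual_ball] - a < f z].

(** The [w^*]-topology is the topology of pointwise convergence on [Z]. *)
Definition rel_wstar_open W : Prop :=
  exists2 U : set {ptws Z -> R}, open U & W = dual_ball `&` U.

Definition minkowski_comb (n : nat) (l : 'I_n -> R)
    (S : 'I_n -> set (Z -> R^o)) : set (Z -> R^o) :=
  [set \sum_(i < n) l i *: f i | f in [set f | forall i, S i (f i)]].

Definition comb_wstar_slices S : Prop :=
  exists n (l : 'I_n -> R) (z : 'I_n -> Z) (a : 'I_n -> R),
    [/\ forall i, 0 < l i, \sum_(i < n) l i = 1, forall i, 0 < a i
      & S = minkowski_comb l (fun i => wstar_slice (z i) (a i))].

Definition rough (e : R) : Prop :=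
  forall z a, 0 < a -> (e%:E <= diam (wstar_slice z a))%E.

Definition weakly_average_rough (e : R) : Prop :=
  forall W, rel_wstar_open W -> W !=set0 -> (e%:E <= diam W)%E.

Definition average_rough (e : R) : Prop :=
  forall S, comb_wstar_slices S -> (e%:E <= diam S)%E.

Definition non_rough : Prop := ~ exists2 e, 0 < e & rough e.

Definition weakly_average_non_rough : Prop :=
  ~ exists2 e, 0 < e & weakly_average_rough e.

Definition average_non_rough : Prop := ~ exists2 e, 0 < e & average_rough e.

Definition nontrivial : Prop := exists z : Z, z != 0.

End roughness.

Arguments non_rough {R} Z.
Arguments weakly_average_non_rough {R} Z.
Arguments average_non_rough {R} Z.
Arguments nontrivial {R} Z.

(* Main.v *)
(** A functional on [X \oplus_p Y] is a pair [(f1, f2)], and a finite set of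
    half-spaces containing it cuts out, once [f2] is fixed, as many half-spaces
    of the dual ball of [X] dilated by some [s > 0] not smaller than the norm of
    [f1]. A set of small diameter in the dual of the sum hence gives one in the
    dual of [X], up to the factor [1/s]. One can take [s = 1] if [p = 1]; in
    general [s >= 1/2] is possible in one of the two coordinates, and for convex
    combinations this needs [p = oo], where the norms of [f1] and [f2] add up to
    at most [1]. Conversely, for [p > 1] the norm of the plane is smooth at
    [(1, 0)], so a functional on the sum that almost attains norm one on a unit
    vector of [X] has a small second coordinate. It then suffices to replace a
    small set in the dual ball of [X] by a small one near the unit sphere, which
    is where Hahn-Banach and the nontriviality of [X] are used. *)
From HB Require Import structures.
Require Import Defs.
From mathcomp Require Import all_boot all_order all_algebra.
From mathcomp Require Import lra.
From mathcomp Require Import all_classical all_reals all_analysis.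
Set Implicit Arguments.
Unset Strict Implicit.
Unset Printing Implicit Defensive.
Import Order.TTheory GRing.Theory Num.Theory.
Import numFieldNormedType.Exports.
Local Open Scope ring_scope.
Local Open Scope classical_set_scope.

(** * Hahn-Banach *)

Section Hahn_Banach.
Context {R : realType} (V : lmodType R).
Implicit Types p q : V -> R.

Definition sublinear p :=
  (forall x y, p (x + y) <= p x + p y) /\
  (forall (s : R) x, 0 < s -> p (s *: x) <= s * p x).

Lemma sublinear0 p : sublinear p -> p 0 = 0.
Proof.
move=> [_ ph]; have two : 0 < 2^-1 :> R by rewrite invr_gt0.
have := ph 2 0 (ltr0Sn _ 1); have := ph _ 0 two; rewrite !scaler0.
by move=> *; lra.
Qed.

Lemma sublinearN p x : sublinear p -> - p (- x) <= p x.
Proof.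
by move=> pS; have := pS.1 x (- x); rewrite subrr sublinear0// => *; lra.
Qed.

Lemma sublinearZ p (s : R) x : sublinear p -> 0 <= s -> p (s *: x) = s * p x.
Proof.
move=> pS; rewrite le0r => /orP[/eqP ->|s0].
  by rewrite scale0r mul0r sublinear0.
apply/eqP; rewrite eq_le pS.2//= -ler_pdivlMl//.
have := pS.2 s^-1 (s *: x); rewrite scalerA mulVf ?gt_eqF// scale1r.
by apply; rewrite invr_gt0.
Qed.

(** For sublinear [p], a sublinear minorant of [p] whose value at [- x] is at most [- p x] (take
    [t = 1]), so that a linear functional below it is forced up to [p x] at [x]. *)
Definition sublinear_lower p x z :=
  inf [set p (z + t *: x) - t * p x | t in [set t : R | 0 <= t]].

Lemma has_inf_sublinear_lower p x z : sublinear p ->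
  has_inf [set p (z + t *: x) - t * p x | t in [set t : R | 0 <= t]].
Proof.
move=> pS; split; first by exists (p (z + 0 *: x) - 0 * p x); exists 0 => /=.
exists (- p (- z)) => _ [t /= t0 <-].
have := pS.1 (z + t *: x) (- z); rewrite addrAC subrr add0r sublinearZ// => *.
by lra.
Qed.

Lemma sublinear_lower_le p x z (t : R) : sublinear p -> 0 <= t ->
  sublinear_lower p x z <= p (z + t *: x) - t * p x.
Proof.
move=> pS t0; apply: ge_inf; last by exists t.
by have [] := has_inf_sublinear_lower x z pS.
Qed.

Lemma sublinear_lower_ge p x z c : sublinear p ->
  (forall t : R, 0 <= t -> c <= p (z + t *: x) - t * p x) ->
  c <= sublinear_lower p x z.
Proof.
move=> pS ct; apply: lb_le_inf => [|_ [t /= t0 <-]]; last exact: ct.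
by have [] := has_inf_sublinear_lower x z pS.
Qed.

(** Parameters [t] for [y] and [u] for [z] combine to [t + u] for [y + z]; likewise [t] for [y]
    corresponds to [s * t] for [s *: y]. *)
Lemma sublinear_lower_sublinear p x :
  sublinear p -> sublinear (sublinear_lower p x).
Proof.
move=> pS; split=> [y z|s y s0].
  rewrite -lerBlDr; apply: sublinear_lower_ge => // t t0.
  rewrite lerBlDr [leRHS]addrC -lerBlDr; apply: sublinear_lower_ge => // u u0.
  have := @sublinear_lower_le p x (y + z) (t + u) pS (addr_ge0 t0 u0).
  rewrite scalerDl addrACA; have := pS.1 (y + t *: x) (z + u *: x).
  by rewrite mulrDl => *; lra.
rewrite -ler_pdivrMl//; apply: sublinear_lower_ge => // t t0.
rewrite ler_pdivrMl//.
have := @sublinear_lower_le p x (s *: y) (s * t) pS (mulr_ge0 (ltW s0) t0).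
by rewrite -scalerA -scalerDr (sublinearZ (p := p)) ?(ltW s0)// mulrBr mulrA.
Qed.

(** Minimality forces [sublinear_lower p x = p] for every [x]; its bound at [t = 1] then reads
    [p z + p x <= p (z + x)], the converse of subadditivity. *)
Lemma minimal_sublinear_linear p : sublinear p ->
  (forall q, sublinear q -> (forall z, q z <= p z) -> q = p) ->
  forall a x y, p (a *: x + y) = a * p x + p y.
Proof.
move=> pS pmin.
have lowerE x : sublinear_lower p x = p.
  apply: pmin => [|z]; first exact: sublinear_lower_sublinear.
  have := @sublinear_lower_le p x z 0 pS (lexx _).
  by rewrite scale0r addr0 mul0r subr0.
have pD x y : p (x + y) = p x + p y.
  apply/eqP; rewrite eq_le pS.1 /=.
  have := @sublinear_lower_le p y x 1 pS ler01.
  by rewrite lowerE scale1r mul1r => *; lra.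
have pN x : p (- x) = - p x.
  by apply/eqP; rewrite -subr_eq0 opprK -pD addNr sublinear0.
move=> a x y; rewrite pD; congr (_ + _).
have [a0|a0] := leP 0 a; first exact: sublinearZ.
by rewrite -[a]opprK scaleNr pN (sublinearZ _ pS) ?oppr_ge0 ?ltW// !mulNr.
Qed.

(* Zorn's lemma is applied to the reversed pointwise order: a chain of
   sublinear minorants of [q] has its pointwise infimum as a lower bound. *)
Lemma linear_le_sublinear q : sublinear q ->
  exists f : V -> R, (forall a x y, f (a *: x + y) = a * f x + f y) /\
    forall z, f z <= q z.
Proof.
move=> qS.
pose below p := sublinear p /\ forall z, p z <= q z.
pose T := sig below.
pose le (p p' : T) := `[< forall z, sval p' z <= sval p z >].
have [||||[p [pS pq]] pmin] := @Zorn T le.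
- by move=> p; apply/asboolP.
- move=> a b c /asboolP ab /asboolP bc; apply/asboolP => z.
  exact: le_trans (bc z) (ab z).
- move=> [a Ha] [b Hb] /asboolP /= ab /asboolP /= ba; apply: eq_exist.
  by apply/funext => z; apply/eqP; rewrite eq_le ab ba.
- move=> A Atot; have [->|/set0P[p0 Ap0]] := eqVneq A set0.
    by exists (exist below q (conj qS (fun=> lexx _))) => s [].
  pose E z := [set sval p z | p in A].
  have Einf z : has_inf (E z).
    split; first by exists (sval p0 z); exists p0.
    exists (- q (- z)) => _ [[p [pS pq]] _ <-] /=.
    by apply: le_trans (sublinearN z pS); rewrite lerN2.
  have Ele z (p : T) : A p -> inf (E z) <= sval p z.
    by move=> Ap; apply: ge_inf; [have [] := Einf z|exists p].
  have iS : sublinear (fun z => inf (E z)).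
    split=> [x y|s x s0].
      rewrite -lerBlDr; apply: lb_le_inf => [|_ [p Ap <-]].
        by have [] := Einf x.
      rewrite lerBlDr [leRHS]addrC -lerBlDr; apply: lb_le_inf => [|_ [p' Ap' <-]].
        by have [] := Einf y.
      (* The chain makes [p] and [p'] comparable; the smaller one, evaluated at [x + y], bounds the
         infimum there. *)
      have [/asboolP pp'|/asboolP pp'] := Atot _ _ Ap Ap'.
        have := (svalP p').1.1 x y; have := pp' x; have := Ele (x + y) _ Ap'.
        by move=> *; lra.
      have := (svalP p).1.1 x y; have := pp' y; have := Ele (x + y) _ Ap.
      by move=> *; lra.
    rewrite -ler_pdivrMl//; apply: lb_le_inf => [|_ [p Ap <-]].
      by have [] := Einf x.
    by rewrite ler_pdivrMl//; apply: le_trans (Ele _ _ Ap) ((svalP p).1.2 s x s0).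
  have iq z : inf (E z) <= q z by apply: le_trans (Ele z _ Ap0) ((svalP p0).2 z).
  by exists (exist below _ (conj iS iq)) => p Ap; apply/asboolP => z /=; exact: Ele.
exists p; split=> //; apply: minimal_sublinear_linear => // p' p'S p'p.
have p'q z : p' z <= q z by apply: le_trans (p'p z) (pq z).
have := pmin (exist below p' (conj p'S p'q)).
by move=> /(_ (asboolT p'p)) [].
Qed.

End Hahn_Banach.

(** The linear minorant is taken below [sublinear_lower] of the norm at [x], not below the norm
    itself: at [- x] this bounds [f (- x)] by minus the norm of [x]. *)
Lemma exists_norming_functional {R : realType} (V : normedModType R) (x : V) :
  exists f : V -> R, [/\ forall a y z, f (a *: y + z) = a * f y + f z,
    forall z, f z <= `|z| & f x = `|x|].
Proof.
have nS : sublinear (fun z : V => `|z|).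
  split=> [y z|s y s0]; first exact: ler_normD.
  by rewrite normrZ gtr0_norm.
have [f [fL fle]] := linear_le_sublinear (sublinear_lower_sublinear x nS).
have fn z : f z <= `|z|.
  have := @sublinear_lower_le _ _ _ x z 0 nS (lexx _).
  by rewrite scale0r addr0 mul0r subr0; exact: le_trans (fle z).
exists f; split=> //; apply/eqP; rewrite eq_le fn /=.
have f0 : f 0 = 0 by have := fL (-1) 0 0; rewrite scaler0 addr0 => *; lra.
have := fL (-1) x 0; rewrite scaleN1r addr0 f0 => fNx.
have := @sublinear_lower_le _ _ _ x (- x) 1 nS ler01.
by rewrite scale1r addNr normr0 => *; have := fle (- x); lra.
Qed.

(** * The dual ball and its slices *)

Section dual_ball_theory.
Context {R : realType} {Z : normedModType R}.
Implicit Types (f g h : Z -> R^o) (S W : set (Z -> R^o)) (l : seq (Z * R)).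

Lemma linear_funN f : linear f -> forall x, f (- x) = - f x.
Proof.
move=> fL x; have f0 := fL (-1) 0 0; rewrite scaler0 addr0 in f0.
have {}f0 : f 0 = 0 by rewrite f0 scaleN1r addNr.
by have := fL (-1) x 0; rewrite !scaleN1r addr0 f0 addr0.
Qed.

Lemma linear_funB f g : linear f -> linear g -> linear (f - g).
Proof.
move=> fL gL a x y; rewrite !fctE /= fL gL.
by rewrite scalerBr opprD addrACA.
Qed.

Lemma has_sup_dual_norm f : continuous_dual f ->
  has_sup [set `|f z| | z in [set z | `|z| <= 1]].
Proof.
move=> [fL fC]; split; first by exists `|f 0|, 0 => //=; rewrite normr0.
pose F : {linear Z -> R^o} := HB.pack f (GRing.isLinear.Build R Z R^o _ f fL).
have /linear_bounded_continuous/bounded_funP/(_ 1)[M FM] : continuous F by [].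
by exists M => _ [z /= z1 <-]; exact: FM.
Qed.

(** A one-sided bound suffices because [z] may be replaced by [- z]. This removes suprema and
    absolute values from the later estimates. *)
Lemma dual_normP f (e : R) : continuous_dual f -> 0 <= e ->
  dual_norm f <= e <-> forall z, f z <= e * `|z|.
Proof.
move=> fD e0; have [fL _] := fD; split=> [fe z|fe]; last first.
  apply: ge_sup => [|_ [z /= z1 <-]]; first by have [] := has_sup_dual_norm fD.
  have ez : e * `|z| <= e by rewrite ler_piMr.
  rewrite ler_norml (le_trans (fe z))// andbT.
  by rewrite lerNl -linear_funN// (le_trans (fe _))// normrN.
have [->|z0] := eqVneq z 0.
  have := linear_funN fL 0; rewrite oppr0 => f0.
  by rewrite normr0 mulr0; have : f 0 = - f 0 := f0; lra.
have nz : 0 < `|z| by rewrite normr_gt0.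
have -> : f z = `|z| * f (`|z|^-1 *: z).
  have := fL `|z|^-1 z 0; rewrite addr0.
  have := linear_funN fL 0; rewrite oppr0 => f0.
  have -> : f 0 = 0 by have : f 0 = - f 0 := f0; lra.
  by rewrite addr0 => ->; rewrite mulrA divff ?gt_eqF// mul1r.
rewrite mulrC ler_pM2r//; apply: le_trans fe; apply: le_trans (ler_norm _) _.
apply: ub_le_sup; first by have [] := has_sup_dual_norm fD.
by exists (`|z|^-1 *: z) => //=; rewrite normrZ gtr0_norm ?invr_gt0// mulVf ?gt_eqF.
Qed.

Lemma linear_le_norm_continuous f (M : R) :
  linear f -> (forall z, f z <= M * `|z|) -> continuous f.
Proof.
move=> fL fle.
pose F : {linear Z -> R^o} := HB.pack f (GRing.isLinear.Build R Z R^o _ f fL).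
suff : continuous F by [].
apply/linear_bounded_continuous/bounded_funP => r; exists (`|M| * r) => x xr.
have le (z : Z) : M * `|z| <= `|M| * `|z| by rewrite ler_wpM2r// ler_norm.
have : `|M| * `|x| <= `|M| * r by rewrite ler_wpM2l.
move=> Mr; rewrite ler_norml; apply/andP; split; last first.
  by rewrite (le_trans (fle x))// (le_trans (le x)).
rewrite lerNl -linear_funN// (le_trans (fle _))// (le_trans (le _))//.
by rewrite normrN.
Qed.

(** Continuity follows from the bound, so a functional built later needs only linearity and
    domination by the norm. *)
Lemma dual_ballP f :
  dual_ball f <-> linear f /\ forall z, f z <= `|z|.
Proof.
split=> [[fD f1]|[fL fle]].
  split=> [|z]; first by case: fD.
  by have /dual_normP := f1; move=> /(_ fD ler01 z); rewrite mul1r.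
have fD : continuous_dual f.
  split=> //; apply: (@linear_le_norm_continuous _ 1) => // z.
  by rewrite mul1r.
by split=> //; apply/dual_normP => // z; rewrite mul1r.
Qed.

Lemma dual_ball_linear f : dual_ball f -> linear f.
Proof. by case/dual_ballP. Qed.

Lemma dual_ball_le f z : dual_ball f -> f z <= `|z|.
Proof. by case/dual_ballP. Qed.

Lemma dual_ballN f z : dual_ball f -> f (- z) = - f z.
Proof. by move/dual_ball_linear/linear_funN. Qed.

Lemma dual_ballD f x y : dual_ball f -> f (x + y) = f x + f y.
Proof. by move=> /dual_ball_linear/(_ 1 x y); rewrite !scale1r. Qed.

Lemma dual_ball_eval0 f : dual_ball f -> f 0 = 0.
Proof. by move=> fB; have := dual_ballN 0 fB; rewrite oppr0 => *; lra. Qed.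

Lemma dual_ballZ f (a : R) x : dual_ball f -> f (a *: x) = a * f x.
Proof.
move=> fB; rewrite -[a *: x]addr0; have /(_ a x 0) -> := dual_ball_linear fB.
by rewrite (dual_ball_eval0 fB) addr0.
Qed.

Lemma exists_dual_ball_norm (x : Z) : exists2 f, dual_ball f & f x = `|x|.
Proof.
have [f [fL fle fx]] := exists_norming_functional x.
by exists f => //; apply/dual_ballP.
Qed.

Lemma dual_ball0 : dual_ball (0 : Z -> R^o).
Proof.
apply/dual_ballP; split=> [a x y|z]; last exact: normr_ge0.
by rewrite [RHS](_ : _ = a *: 0 + 0)// scaler0 addr0.
Qed.

Lemma dual_norm_ge0 f : continuous_dual f -> 0 <= dual_norm f.
Proof.
move=> fD; apply: le_trans (normr_ge0 (f 0)) _; apply: ub_le_sup.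
  by have [] := has_sup_dual_norm fD.
by exists 0 => //=; rewrite normr0.
Qed.

Lemma dual_norm_le f z : dual_ball f -> f z <= dual_norm f * `|z|.
Proof.
by move=> -[fD _]; have /dual_normP := lexx (dual_norm f); apply=> //;
  exact: dual_norm_ge0.
Qed.

Lemma dual_norm_adherent f (e : R) : dual_ball f -> 0 < e ->
  exists2 z, `|z| <= 1 & dual_norm f - e < f z.
Proof.
move=> fB e0; have [fD _] := fB.
have [_ [z /= z1 <-] fz] := sup_adherent e0 (has_sup_dual_norm fD).
have [f0|f0] := leP 0 (f z); first by exists z => //; rewrite -(ger0_norm f0).
by exists (- z); rewrite ?normrN// (dual_ballN _ fB) -(ltr0_norm f0).
Qed.

(** Singletons [l] give the slices, arbitrary [l] a base of the relative
    w*-topology. *)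
Definition wcap l : set (Z -> R^o) :=
  [set f | dual_ball f /\ forall u, u \in l -> u.2 < f u.1].

(** Diameter at most [e], free of suprema and extended reals; exchanging [f] and [g] supplies the
    absolute value. It is vacuous for empty [S], so nonemptiness is tracked separately. *)
Definition small S (e : R) :=
  forall f g, S f -> S g -> forall z, f z - g z <= e * `|z|.

Lemma small_le S (e e' : R) : e <= e' -> small S e -> small S e'.
Proof.
by move=> ee Se f g Sf Sg z; apply: le_trans (Se _ _ Sf Sg z) _; rewrite ler_wpM2r.
Qed.

Lemma sub_small S S' (e : R) : S `<=` S' -> small S' e -> small S e.
Proof. by move=> SS' Se f g /SS' Sf /SS' Sg; exact: Se. Qed.

Lemma diam_le S (e : R) : S `<=` @dual_ball R Z -> 0 <= e ->
  (diam S <= e%:E)%E <-> small S e.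
Proof.
move=> SB e0.
have dualB f g : S f -> S g -> continuous_dual (f - g).
  move=> /SB fB /SB gB; have fL := dual_ball_linear fB.
  have fgL := linear_funB fL (dual_ball_linear gB).
  split=> //; apply: (@linear_le_norm_continuous _ 2) => // z.
  rewrite !fctE /= -(dual_ballN _ gB) mulrDl mul1r lerD// ?dual_ball_le//.
  by rewrite -[leRHS]normrN dual_ball_le.
split=> [Se f g Sf Sg z|Se].
  have : dual_norm (f - g) <= e.
    by rewrite -lee_fin; apply: le_trans Se;
      apply: ereal_sup_ubound; exists f => //; exists g.
  by move/dual_normP; apply=> //; exact: dualB.
apply: ge_ereal_sup => _ [f Sf [g Sg <-]]; rewrite lee_fin.
by apply/dual_normP => //; [exact: dualB|exact: Se].
Qed.

(** Common form of the three negated roughness notions, with [A] the slices, the nonempty relatively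
    open sets, or the convex combinations of slices. *)
Lemma exists_small_diam (A : set (set (Z -> R^o))) :
  (forall S, A S -> S `<=` @dual_ball R Z) ->
  (~ exists2 e : R, 0 < e & forall S, A S -> (e%:E <= diam S)%E) <->
  forall e : R, 0 < e -> exists2 S, A S & small S e.
Proof.
move=> AB; split=> [rough e e0|Asmall [e e0 rough]].
  apply: contra_notP rough => nS; exists e => // S AS; rewrite leNgt.
  apply/negP => Se; apply: nS; exists S => //.
  by apply/(diam_le (AB _ AS) (ltW e0))/ltW.
(* Smallness gives a non-strict bound, so half of [e] is used to contradict [e <= diam S]. *)
have e2 : 0 < e / 2 by rewrite divr_gt0.
have [S AS /(diam_le (AB _ AS) (ltW e2)) Se] := Asmall _ e2.
have := le_trans (rough _ AS) Se; rewrite lee_fin => *; lra.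
Qed.

Lemma wcap_sub l : wcap l `<=` @dual_ball R Z.
Proof. by move=> f []. Qed.

Lemma wcap1P f z c : wcap [:: (z, c)] f <-> dual_ball f /\ c < f z.
Proof.
by split=> -[fB fl]; split=> //; [apply: (fl (z, c)); rewrite inE|
  move=> u; rewrite inE => /eqP ->].
Qed.

Let s (z : Z) := sup [set g z | g in @dual_ball R Z].

Let has_sup_s z : has_sup [set g z | g in @dual_ball R Z].
Proof.
split; first by exists 0, 0 => //; exact: dual_ball0.
by exists `|z| => _ [g gB <-]; exact: dual_ball_le.
Qed.

Lemma wstar_slice_wcap z a : wstar_slice z a = wcap [:: (z, s z - a)].
Proof. by apply/seteqP; split=> f /wcap1P. Qed.

Lemma wstar_slice_neq0 (z : Z) (a : R) : 0 < a -> wstar_slice z a !=set0.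
Proof.
move=> a0; have [_ [g gB <-] gz] := sup_adherent a0 (has_sup_s z).
by exists g.
Qed.

(** Nonemptiness puts the level [c] strictly below the supremum, so levels may be arbitrary reals
    from here on. *)
Lemma wcap_wstar_slice z c : wcap [:: (z, c)] !=set0 ->
  exists2 a, 0 < a & wcap [:: (z, c)] = wstar_slice z a.
Proof.
move=> [f /wcap1P[fB cf]]; exists (s z - c).
  rewrite subr_gt0; apply: lt_le_trans cf _; apply: ub_le_sup; last by exists f.
  by have [] := has_sup_s z.
by rewrite wstar_slice_wcap; congr (wcap [:: (_, _)]); lra.
Qed.

Lemma wcap_rel_wstar_open l : rel_wstar_open (wcap l).
Proof.
exists [set g | forall u, u \in l -> u.2 < g u.1]; last by [].
elim: l => [|u l IHl]; first by rewrite (_ : mkset _ = setT) ?seteqP//; exact: openT.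
rewrite (_ : mkset _ = [set g | u.2 < g u.1] `&`
    [set g | forall u, u \in l -> u.2 < g u.1]).
  apply: openI IHl.
  rewrite (_ : mkset _ = (fun g : {ptws Z -> R} => g u.1) @^-1` [set x | u.2 < x])//.
  apply: open_comp; last exact: open_gt.
  move=> g _; suff /pointwise_cvgP :
    {ptws, nbhs (g : {ptws Z -> R}) --> (g : Z -> R)} by exact.
  exact: cvg_id.
apply/seteqP; split=> g /=.
  by move=> H; split=> [|v vl]; apply: H; rewrite inE ?eqxx ?vl ?orbT.
by move=> [gu H] v; rewrite inE => /orP[/eqP ->//|]; exact: H.
Qed.

(** The filter generated by the sets [wcap l] containing [f] converges pointwise to [f], hence
    contains every open set around [f]. *)
Lemma rel_wstar_open_wcap W f : rel_wstar_open W -> W f ->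
  exists2 l, wcap l f & wcap l `<=` W.
Proof.
move=> [U Uo ->] [fB Uf].
pose F : set_system {ptws Z -> R} := [set A | exists2 l, wcap l f & wcap l `<=` A].
have FF : Filter F.
  split=> [|A B [l lf lA] [l' lf' lB]|A B AB [l lf lA]].
  - by exists [::].
  - exists (l ++ l').
      split=> // u; rewrite mem_cat => /orP[|].
        by case: lf => _; exact.
      by case: lf' => _; exact.
    by move=> g [gB gl]; split; [apply: lA|apply: lB]; split=> // u ul;
      apply: gl; rewrite mem_cat ul ?orbT.
  - by exists l => //; exact: subset_trans lA AB.
have Ff : {ptws, F --> (f : Z -> R)}.
  apply/pointwise_cvgP => t; apply/cvgrPdist_lt => e e0.
  (* Constraints are lower bounds only; the one at [- t] bounds [g t] from above. *)
  exists [:: (t, f t - e); (- t, f (- t) - e)].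
    by split=> // u; rewrite !inE => /orP[]/eqP -> /=; lra.
  move=> g [gB gl] /=.
  have /= := gl (t, f t - e); rewrite !inE eqxx => /(_ isT) g1.
  have /= := gl (- t, f (- t) - e); rewrite !inE eqxx orbT => /(_ isT).
  rewrite (dual_ballN _ gB) (dual_ballN _ fB) => g2.
  by rewrite ltr_norml; apply/andP; split; lra.
have [l lf lU] : F U by apply: Ff; exact: open_nbhs_nbhs.
by exists l => // g lg; split; [exact: wcap_sub lg|exact: lU].
Qed.

(** The predicate on the number of half-spaces lets one proof serve two notions: [pred1 1] gives
    slices and [predT] gives relatively w*-open sets. *)
Definition small_wcaps (P : pred nat) := forall e : R, 0 < e ->
  exists l, [/\ P (size l), wcap l !=set0 & small (wcap l) e].

Definition slice_comb n (w : 'I_n -> R) (z : 'I_n -> Z) (c : 'I_n -> R) :=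
  minkowski_comb w (fun i => wcap [:: (z i, c i)]).

Definition small_slice_combs := forall e : R, 0 < e ->
  exists n (w : 'I_n -> R) (z : 'I_n -> Z) (c : 'I_n -> R),
  [/\ forall i, 0 < w i, \sum_(i < n) w i = 1,
    forall i, wcap [:: (z i, c i)] !=set0 & small (slice_comb w z c) e].

Lemma sum_funE n (F : 'I_n -> Z -> R^o) z :
  (\sum_(i < n) F i) z = \sum_(i < n) F i z.
Proof. by elim/big_ind2 : _ => // a b c d <- <-. Qed.

Lemma dual_ball_conv n (w : 'I_n -> R) (f : 'I_n -> Z -> R^o) :
  (forall i, 0 <= w i) -> \sum_(i < n) w i <= 1 ->
  (forall i, dual_ball (f i)) -> dual_ball (\sum_(i < n) w i *: f i).
Proof.
move=> w0 w1 fB; apply/dual_ballP; split=> [a x y|z].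
  rewrite !sum_funE scaler_sumr -big_split; apply: eq_bigr => i _ /=.
  rewrite /GRing.scale/= /GRing.scale/= (dual_ballD _ _ (fB i)) (dual_ballZ _ _ (fB i)).
  by rewrite mulrDr mulrCA.
rewrite sum_funE; apply: (@le_trans _ _ (\sum_(i < n) w i * `|z|)).
  by apply: ler_sum => i _; rewrite ler_wpM2l// dual_ball_le.
by rewrite -mulr_suml ler_piMl.
Qed.

Lemma non_roughP : non_rough Z <-> small_wcaps (pred1 1%N).
Proof.
rewrite /non_rough /rough.
pose A := [set S | exists z a, 0 < a /\ S = @wstar_slice R Z z a].
have -> : (exists2 e : R, 0 < e &
      forall z a, 0 < a -> (e%:E <= diam (@wstar_slice R Z z a))%E) =
    (exists2 e : R, 0 < e & forall S, A S -> (e%:E <= diam S)%E).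
  apply/propext; split=> -[e e0 H]; exists e => //.
    by move=> _ [z [a [a0 ->]]]; exact: H.
  by move=> z a a0; apply: H; exists z, a.
have AB S : A S -> S `<=` @dual_ball R Z by move=> [z [a [_ ->]]] f [].
apply: (iff_trans (exists_small_diam AB)).
split=> H e /H.
  move=> [_ [z [a [a0 ->]]] Se]; exists [:: (z, s z - a)].
  by rewrite -wstar_slice_wcap; split=> //; exact: wstar_slice_neq0.
move=> [l [/eqP]]; case: l => [|[z c] [|//]] //= _.
move=> /wcap_wstar_slice[a a0 ->] Se.
by exists (wstar_slice z a) => //; exists z, a.
Qed.

(** A nonempty relatively open set contains a nonempty basic one, and smallness passes to
    subsets. *)
Lemma weakly_average_non_roughP :
  weakly_average_non_rough Z <-> small_wcaps predT.
Proof.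
rewrite /weakly_average_non_rough /weakly_average_rough.
pose A := [set W | @rel_wstar_open R Z W /\ W !=set0].
have -> : (exists2 e : R, 0 < e &
      forall W, @rel_wstar_open R Z W -> W !=set0 -> (e%:E <= diam W)%E) =
    (exists2 e : R, 0 < e & forall S, A S -> (e%:E <= diam S)%E).
  by apply/propext; split=> -[e e0 H]; exists e => //; [move=> S []; exact: H|
    move=> W ? ?; apply: H].
have AB S : A S -> S `<=` @dual_ball R Z by move=> [[U _ ->] _] f [].
apply: (iff_trans (exists_small_diam AB)).
split=> H e /H.
  move=> [W [Wo [f Wf]] We]; have [l lf lW] := rel_wstar_open_wcap Wo Wf.
  by exists l; split=> //; [exists f|exact: sub_small We].
move=> [l [_ l0 le]]; exists (wcap l) => //; split=> //.
exact: wcap_rel_wstar_open.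
Qed.

Lemma average_non_roughP : average_non_rough Z <-> small_slice_combs.
Proof.
have AB S : comb_wstar_slices S -> S `<=` @dual_ball R Z.
  move=> [n [w [z [a [w0 w1 _ ->]]]]] _ [f fS <-]; apply: dual_ball_conv.
  - by move=> i; exact: ltW.
  - by rewrite w1.
  - by move=> i; have [] := fS i.
apply: (iff_trans (exists_small_diam AB)); split=> H e /H.
  move=> [_ [n [w [z [a [w0 w1 a0 ->]]]]] Se].
  exists n, w, z, (fun i => s (z i) - a i); split=> //.
    by move=> i; rewrite -wstar_slice_wcap; exact: wstar_slice_neq0.
  rewrite /slice_comb (_ : (fun i => wcap _) = fun i => wstar_slice (z i) (a i))//.
  by apply/funext => i; rewrite wstar_slice_wcap.
move=> [n [w [z [c [w0 w1 S0 Se]]]]].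
have /choice[a aS] i : exists a : R, 0 < a /\ wcap [:: (z i, c i)] = wstar_slice (z i) a.
  by have [a ? ?] := wcap_wstar_slice (S0 i); exists a.
exists (slice_comb w z c) => //; exists n, w, z, a; split=> //.
  by move=> i; have [] := aS i.
by rewrite /slice_comb; congr minkowski_comb; apply/funext => i; have [] := aS i.
Qed.

End dual_ball_theory.

(** * Small sets near the unit sphere of the dual *)

Section peaks.
Context {R : realType} {Z : normedModType R}.
Implicit Types (f g h : Z -> R^o) (l : seq (Z * R)).

Lemma wcap_map_sub (T : normedModType R) (L : seq (T * R))
    (u : T * R -> Z * R) g (f : T -> R^o) :
  dual_ball f -> wcap (map u L) g ->
  (forall v, v \in L -> (u v).2 < g (u v).1 -> v.2 < f v.1) -> wcap L f.
Proof.
by move=> fB [_ gL] H; split=> // v vL; apply: H => //; apply/gL/map_f.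
Qed.

Lemma dual_ball_divZ f (s : R) : dual_ball f -> 0 < s -> dual_norm f <= s ->
  dual_ball (fun z => s^-1 * f z : R^o).
Proof.
move=> fB s0 fs; apply/dual_ballP; split=> [a x y|z].
  rewrite (dual_ballD _ _ fB) (dual_ballZ _ _ fB) mulrDr; congr (_ + _).
  exact: mulrCA.
rewrite ler_pdivrMl//; apply: le_trans (dual_norm_le z fB) _.
by rewrite ler_wpM2r.
Qed.

Lemma dual_norm_mul_le f (r c : R) : dual_ball f -> 0 <= r ->
  (forall z, `|z| <= r -> f z <= c) -> dual_norm f * r <= c.
Proof.
move=> fB; rewrite le0r => /orP[/eqP -> fc|r0 fc].
  by rewrite mulr0 -(dual_ball_eval0 fB) fc// normr0.
rewrite -ler_pdivlMr//; apply: ge_sup => [|_ [z /= z1 <-]].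
  by exists `|f 0|, 0 => //=; rewrite normr0.
have rz : `|r *: z| <= r by rewrite normrZ gtr0_norm// ler_piMr// ltW.
rewrite ler_pdivlMr// mulrC -[r in X in X <= _]gtr0_norm// -normrM.
rewrite -(dual_ballZ _ _ fB) ler_norml fc// andbT.
by rewrite lerNl -(dual_ballN _ fB) fc// normrN.
Qed.

Lemma exists_peak : nontrivial Z ->
  exists x : Z, `|x| = 1 /\ exists2 h, dual_ball h & h x = 1.
Proof.
move=> [x x0]; have nx : 0 < `|x| by rewrite normr_gt0.
have x1 : `| `|x|^-1 *: x | = 1.
  by rewrite normrZ gtr0_norm ?invr_gt0// mulVf ?gt_eqF.
have [h hB hx] := exists_dual_ball_norm (`|x|^-1 *: x).
by exists (`|x|^-1 *: x); split=> //; exists h => //; rewrite hx.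
Qed.

(** Normalise [z] and raise the level to at least [1 - e]: this can only shrink the slice, and a
    functional norming [z] stays in it. If [z = 0], the given slice is the whole ball and any peak
    will do. *)
Lemma exists_peaked_slice (z : Z) (c e : R) : nontrivial Z ->
  wcap [:: (z, c)] !=set0 -> 0 < e ->
  exists x c', [/\ `|x| <= 1, 1 - e <= c', wcap [:: (x, c')] !=set0
    & wcap [:: (x, c')] `<=` wcap [:: (z, c)]].
Proof.
move=> Znt [f /wcap1P[fB cf]] e0; have [z0|z0] := eqVneq z 0.
  have [x [x1 [h hB hx]]] := exists_peak Znt.
  exists x, (1 - e); split; rewrite ?x1//.
    by exists h; apply/wcap1P; split=> //; rewrite hx; lra.
  move=> g /wcap1P[gB _]; apply/wcap1P; split=> //.
  by rewrite z0 (dual_ball_eval0 gB) -(dual_ball_eval0 fB) -z0.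
have nz : 0 < `|z| by rewrite normr_gt0.
have [h hB hz] := exists_dual_ball_norm z.
exists (`|z|^-1 *: z), (Num.max (1 - e) (c / `|z|)); split.
- by rewrite normrZ gtr0_norm ?invr_gt0// mulVf ?gt_eqF.
- by rewrite le_max lexx.
- exists h; apply/wcap1P; split=> //.
  rewrite (dual_ballZ _ _ hB) hz mulVf ?gt_eqF// gt_max; apply/andP; split.
    by lra.
  by rewrite ltr_pdivrMr// mul1r; apply: lt_le_trans cf _; exact: dual_ball_le.
- move=> g /wcap1P[gB]; rewrite gt_max (dual_ballZ _ _ gB) => /andP[_].
  by rewrite mulrC ltr_pM2l ?invr_gt0// => cg; apply/wcap1P.
Qed.

(** The point [x] certifies that every member has norm close to one, which on a sum makes the other
    coordinate small. *)
Definition peaked_small_wcaps (P : pred nat) := forall e d : R, 0 < e -> 0 < d ->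
  exists l x, [/\ P (size l), `|x| <= 1, wcap l !=set0, small (wcap l) e
    & forall f, wcap l f -> 1 - d < f x].

Lemma peaked_slices : nontrivial Z ->
  @small_wcaps R Z (pred1 1%N) -> peaked_small_wcaps (pred1 1%N).
Proof.
move=> Znt Zs e d e0 d0; have [l [/eqP + l0 lS]] := Zs _ e0.
case: l l0 lS => [|[z c] [|//]] //= l0 lS _.
have [x [c' [x1 c'd l'0 l'l]]] := exists_peaked_slice Znt l0 d0.
exists [:: (x, c')], x; split=> //; first exact: sub_small lS.
by move=> f /wcap1P[_]; exact: le_lt_trans.
Qed.

Lemma wcap_margin l f : wcap l f ->
  exists2 e : R, 0 < e & forall u, u \in l -> u.2 + e <= f u.1.
Proof.
move=> [_]; elim: l => [|u l IHl] fl; first by exists 1.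
have [v vl|e e0 le] := IHl; first by apply: fl; rewrite inE vl orbT.
have := fl u; rewrite inE eqxx => /(_ isT) fu.
exists (Num.min e (f u.1 - u.2)) => [|v].
  by rewrite lt_min e0 subr_gt0.
rewrite inE => /orP[/eqP ->|/le vl].
  by rewrite -lerBrDl ge_min lexx orbT.
by apply: le_trans vl; rewrite lerD2l ge_min lexx.
Qed.

(* A small weak* neighbourhood of [f] need not meet the unit sphere when [Z] is
   finite-dimensional. It is dilated by [1 / dual_norm f] if [f] is large;
   otherwise its translate to a norm-one functional is still small, because
   [f + (g1 - g2) / 4] stays in the ball for [g1] and [g2] in the ball. *)
Lemma peaked_wcaps : nontrivial Z ->
  @small_wcaps R Z predT -> peaked_small_wcaps predT.
Proof.
(* The factor [1/4] covers both cases: a dilation by at most [2], or the coefficient [1/4] in front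
   of [g1 - g2]. *)
move=> Znt Zs e d e0 d0; have e4 : 0 < e / 4 by rewrite divr_gt0.
have [l [_ [f fl] lS]] := Zs _ e4.
have fB : dual_ball f by case: fl.
have [f2|f2] := leP 2^-1 (dual_norm f).
  have s0 : 0 < dual_norm f by apply: lt_le_trans f2; rewrite invr_gt0.
  set s := dual_norm f in f2 s0.
  (* The error [d * s] becomes [d] after division by [s]. *)
  have [x x1 fx] := dual_norm_adherent fB (mulr_gt0 d0 s0).
  exists ((x, 1 - d) :: [seq (u.1, s^-1 * u.2) | u <- l]), x; split=> //.
  - exists (fun z => s^-1 * f z : R^o); split; first exact: dual_ball_divZ.
    move=> u; rewrite inE => /orP[/eqP ->|/mapP[v vl ->]] /=.
      by rewrite ltr_pdivlMl// mulrBr mulr1 mulrC.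
    by rewrite ltr_pM2l ?invr_gt0//; case: fl => _; exact.
  - have sg g : wcap ((x, 1 - d) :: [seq (u.1, s^-1 * u.2) | u <- l]) g ->
        wcap l (fun z => s * g z : R^o).
      move=> [gB gl]; split.
        apply/dual_ballP; split=> [a y z|z].
          rewrite (dual_ballD _ _ gB) (dual_ballZ _ _ gB) mulrDr; congr (_ + _).
          exact: mulrCA.
        have s1 : s <= 1 by case: fB.
        apply: le_trans (_ : s * `|z| <= _); last by rewrite ler_piMl.
        by rewrite ler_wpM2l ?(ltW s0)// dual_ball_le.
      move=> u ul; have := gl (u.1, s^-1 * u.2).
      rewrite inE map_f ?orbT//= => /(_ isT).
      by rewrite ltr_pdivrMl.
    move=> g1 g2 /sg g1l /sg g2l z; have := lS _ _ g1l g2l z.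
    rewrite -mulrBr -ler_pdivlMl// => /le_trans; apply.
    rewrite mulrA ler_wpM2r// ler_pdivrMl//.
    have : 2^-1 * e <= s * e by rewrite ler_wpM2r// ltW.
    by move=> *; lra.
  - by move=> g [_ gl]; apply: (gl (x, 1 - d)); rewrite inE eqxx.
have [x [x1 [h hB hx]]] := exists_peak Znt.
have [r r0 fr] := wcap_margin fl.
(* The two lists keep [g u.1] within [r] of [h u.1], so [(g1 - g2) / 4] moves each constraint by
   less than [r / 2], inside the margin [r] of [f]. *)
exists ((x, 1 - d) :: [seq (u.1, h u.1 - r) | u <- l] ++
  [seq (- u.1, - h u.1 - r) | u <- l]), x; split; rewrite ?x1//.
- exists h; split=> // u; rewrite inE mem_cat.
  move=> /or3P[/eqP ->|/mapP[v _ ->]|/mapP[v _ ->]] /=.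
  + by rewrite hx; lra.
  + by lra.
  + by rewrite (dual_ballN _ hB); lra.
- move=> g1 g2 [g1B g1l] [g2B g2l] z.
  pose f' : Z -> R^o := fun z => f z + 4^-1 * (g1 z - g2 z).
  suff f'l : wcap l f'.
    by have := lS _ _ f'l fl z; rewrite /f' => *; lra.
  split=> [|u ul].
    apply/dual_ballP; split=> [a y y'|y].
      rewrite /f' (dual_ballD _ _ fB) (dual_ballZ _ _ fB).
      rewrite (dual_ballD _ _ g1B) (dual_ballZ _ _ g1B).
      rewrite (dual_ballD _ _ g2B) (dual_ballZ _ _ g2B).
      by rewrite /GRing.scale/=; lra.
    have := dual_ball_le y g1B; have := dual_ball_le (- y) g2B.
    rewrite normrN (dual_ballN _ g2B); have := dual_norm_le y fB.
    have : dual_norm f * `|y| <= 2^-1 * `|y| by rewrite ler_wpM2r// ltW.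
    by rewrite /f' => *; lra.
  have := g1l (u.1, h u.1 - r); rewrite inE mem_cat.
  rewrite (map_f (fun u => (u.1, h u.1 - r)))// orbT => /(_ isT) /=.
  have := g2l (- u.1, - h u.1 - r); rewrite inE mem_cat.
  rewrite (map_f (fun u => (- u.1, - h u.1 - r)))// !orbT => /(_ isT) /=.
  by rewrite (dual_ballN _ g2B); have := fr _ ul; rewrite /f' => *; lra.
- by move=> g [_ gl]; apply: (gl (x, 1 - d)); rewrite inE eqxx.
Qed.

End peaks.

(** * Absolute sums *)

(** Stated for abstract coordinates so that every lemma about [X] also gives one
    about [Y]. *)
Record absolute_sum (R : realType) (X Y Z : normedModType R) (N : R -> R -> R)
    (j : {linear X -> Z}) (k : {linear Y -> Z})
    (p : {linear Z -> X}) (q : {linear Z -> Y}) : Prop := AbsoluteSum {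
  absolute_sumK : forall z, j (p z) + k (q z) = z;
  absolute_sum_pj : forall x, p (j x) = x;
  absolute_sum_pk : forall y, p (k y) = 0;
  absolute_sum_qj : forall x, q (j x) = 0;
  absolute_sum_qk : forall y, q (k y) = y;
  absolute_sum_norm : forall z, `|z| = N `|p z| `|q z|;
  absolute_sum_homo : forall a b c d, 0 <= a -> 0 <= b ->
    a <= c -> b <= d -> N a b <= N c d;
  absolute_sumC : forall a b, N a b = N b a;
  absolute_sum0 : forall a, 0 <= a -> N a 0 = a }.

Lemma absolute_sum_sym (R : realType) (X Y Z : normedModType R) N
    (j : {linear X -> Z}) (k : {linear Y -> Z})
    (p : {linear Z -> X}) (q : {linear Z -> Y}) :
  absolute_sum N j k p q -> absolute_sum N k j q p.
Proof.
case=> jkK pj pk qj qk nE homo NC N0; split=> // z; first by rewrite addrC.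
by rewrite nE NC.
Qed.

(** * Coordinates of functionals on an absolute sum *)

Section absolute_sum_coordinate.
Context {R : realType} {X Y Z : normedModType R} {N : R -> R -> R}.
Context {j : {linear X -> Z}} {k : {linear Y -> Z}}.
Context {p : {linear Z -> X}} {q : {linear Z -> Y}}.
Hypothesis S : absolute_sum N j k p q.

Lemma norm_inl x : `|j x| = `|x|.
Proof.
rewrite (absolute_sum_norm S) (absolute_sum_pj S) (absolute_sum_qj S).
by rewrite normr0 (absolute_sum0 S).
Qed.

Lemma norm_projl z : `|p z| <= `|z|.
Proof.
rewrite (absolute_sum_norm S) -[leLHS](absolute_sum0 S)//.
exact: (absolute_sum_homo S).
Qed.

Lemma norm_inlr x y : `|j x + k y| = N `|x| `|y|.
Proof.
rewrite (absolute_sum_norm S) !linearD (absolute_sum_pj S) (absolute_sum_pk S).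
by rewrite (absolute_sum_qj S) (absolute_sum_qk S) addr0 add0r.
Qed.

Lemma dual_ball_inl (f : Z -> R^o) : dual_ball f -> dual_ball (f \o j).
Proof.
move=> fB; apply/dual_ballP; split=> [a x y|x] /=.
  by rewrite linearP (dual_ballD _ _ fB) (dual_ballZ _ _ fB).
by rewrite -(norm_inl x); exact: dual_ball_le.
Qed.

Lemma dual_ball_projl (g : X -> R^o) : dual_ball g -> dual_ball (g \o p).
Proof.
move=> gB; apply/dual_ballP; split=> [a x y|z] /=.
  by rewrite linearP (dual_ballD _ _ gB) (dual_ballZ _ _ gB).
by apply: le_trans (norm_projl z); exact: dual_ball_le.
Qed.

Lemma dual_ball_split (f : Z -> R^o) z :
  dual_ball f -> f z = f (j (p z)) + f (k (q z)).
Proof. by move=> fB; rewrite -(dual_ballD _ _ fB) (absolute_sumK S). Qed.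

(** The functional [(s g, h)]. The factor [s] is kept apart so that [g] can range over the whole
    dual ball of [X]. *)
Definition glue (s : R) (g : X -> R) (h : Y -> R) : Z -> R^o :=
  fun z => s * g (p z) + h (q z).

Lemma glue_linear s (g : X -> R^o) (h : Y -> R^o) :
  linear g -> linear h -> linear (glue s g h).
Proof.
move=> gL hL a x y; rewrite /glue !linearP gL hL /GRing.scale/= /GRing.scale/=.
lra.
Qed.

(** The first coordinate of [f] may be replaced by any functional of no larger norm: since [N] is
    monotone, [f] is at most the norm of [z] at all [j x + k (q z)] with [x] no longer than [p z],
    and the supremum over [x] yields the dual norm. *)
Lemma dual_ball_glue_norm (f : Z -> R^o) (g : X -> R^o) :
  dual_ball f -> dual_ball g ->
  dual_ball (glue (dual_norm (f \o j)) g (f \o k)).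
Proof.
move=> fB gB; have fjB := dual_ball_inl fB; apply/dual_ballP; split=> [|z].
  apply: glue_linear; first exact: dual_ball_linear.
  by move=> a x y /=; rewrite linearP (dual_ballD _ _ fB) (dual_ballZ _ _ fB).
have : dual_norm (f \o j) * `|p z| <= `|z| - f (k (q z)).
  apply: dual_norm_mul_le => // x xp /=; rewrite lerBrDr -(dual_ballD _ _ fB).
  apply: le_trans (dual_ball_le _ fB) _.
  by rewrite norm_inlr (absolute_sum_norm S) (absolute_sum_homo S).
have : dual_norm (f \o j) * g (p z) <= dual_norm (f \o j) * `|p z|.
  by rewrite ler_wpM2l ?dual_ball_le// dual_norm_ge0//; case: fjB.
by rewrite /glue /= => *; lra.
Qed.

Lemma wcap_section (s : R) (h : Y -> R) (g : X -> R^o) (u : Z * R) : 0 < s ->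
  ((u.2 - h (q u.1)) / s < g (p u.1)) = (u.2 < glue s g h u.1).
Proof. by move=> s0; rewrite ltr_pdivrMr// ltrBlDr mulrC. Qed.

(* [g |-> glue s g h] maps the section into [wcap l] and dilates distances
   by [s]. *)
Lemma small_wcap_section (s : R) (h : Y -> R) l e : 0 < s ->
  (forall g : X -> R^o, dual_ball g -> dual_ball (glue s g h)) ->
  (exists2 g : X -> R^o, dual_ball g & wcap l (glue s g h)) ->
  small (wcap l) e ->
  exists l' : seq (X * R),
    [/\ size l' = size l, wcap l' !=set0 & small (wcap l') (e / s)].
Proof.
move=> s0 sB [g gB [_ gl]] lS.
exists [seq (p u.1, (u.2 - h (q u.1)) / s) | u <- l].
rewrite size_map; split=> //.
  by exists g; split=> // _ /mapP[u ul ->] /=; rewrite wcap_section//; exact: gl.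
have ml f : wcap [seq (p u.1, (u.2 - h (q u.1)) / s) | u <- l] f ->
    wcap l (glue s f h).
  move=> fl; have fB := wcap_sub fl; apply: wcap_map_sub fl _; first exact: sB.
  by move=> u _ /=; rewrite wcap_section.
move=> f f' /ml fl /ml f'l x; have := lS _ _ fl f'l (j x).
rewrite /glue (absolute_sum_pj S) norm_inl opprD addrACA subrr addr0 -mulrBr.
by rewrite mulrAC ler_pdivlMr// mulrC.
Qed.

(** The first coordinate of a combination of glued functionals is [m] times a convex combination
    with weights [w i * s i / m], where [m] is the sum of the [w i * s i]; hence the factor
    [1 / m]. *)
Lemma small_slice_comb_section n (w s c : 'I_n -> R) (z : 'I_n -> Z)
    (h : 'I_n -> Y -> R) e : 0 < \sum_(i < n) w i * s i ->
  (forall i, 0 < w i) -> (forall i, 0 < s i) ->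
  (forall i (g : X -> R^o), dual_ball g -> dual_ball (glue (s i) g (h i))) ->
  (forall i, exists2 g : X -> R^o, dual_ball g &
    wcap [:: (z i, c i)] (glue (s i) g (h i))) ->
  small (slice_comb w z c) e ->
  exists (w' : 'I_n -> R) (x : 'I_n -> X) (c' : 'I_n -> R),
    [/\ forall i, 0 < w' i, \sum_(i < n) w' i = 1,
      forall i, wcap [:: (x i, c' i)] !=set0 &
      small (slice_comb w' x c') (e / \sum_(i < n) w i * s i)].
Proof.
set m := \sum_(i < n) w i * s i => m0 w0 s0 sB sz zS.
exists (fun i => w i * s i / m), (fun i => p (z i)),
  (fun i => (c i - h i (q (z i))) / s i); split.
- by move=> i; rewrite divr_gt0// mulr_gt0.
- by rewrite -mulr_suml divff ?gt_eqF.
- move=> i; have [g gB /wcap1P[_ gz]] := sz i; exists g; apply/wcap1P; split=> //.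
  by rewrite (wcap_section _ _ (z i, c i)).
have ml (f : 'I_n -> X -> R^o) i :
    wcap [:: (p (z i), (c i - h i (q (z i))) / s i)] (f i) ->
    wcap [:: (z i, c i)] (glue (s i) (f i) (h i)).
  move=> /wcap1P[fB]; rewrite (wcap_section _ _ (z i, c i))// => fz.
  by apply/wcap1P; split=> //; exact: sB.
move=> _ _ [f fz <-] [f' f'z <-] x.
have := zS (\sum_(i < n) w i *: glue (s i) (f i) (h i))
  (\sum_(i < n) w i *: glue (s i) (f' i) (h i)).
move=> /(_ _ _ (j x)); rewrite norm_inl !sum_funE -!sumrB.
have -> : \sum_(i < n) ((w i *: glue (s i) (f i) (h i)) (j x) -
    (w i *: glue (s i) (f' i) (h i)) (j x)) =
    m * \sum_(i < n) (((w i * s i / m) *: f i) x - ((w i * s i / m) *: f' i) x).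
  rewrite mulr_sumr; apply: eq_bigr => i _; rewrite !fctE /glue/=.
  rewrite (absolute_sum_pj S) /GRing.scale/= -!mulrBr opprD addrACA subrr addr0.
  by rewrite -mulrBr [RHS]mulrA (mulrCA m) divff ?gt_eqF// mulr1 mulrA.
rewrite -ler_pdivlMl// mulrA [m^-1 * e]mulrC; apply.
  by exists (fun i => glue (s i) (f i) (h i)) => // i; exact: ml.
by exists (fun i => glue (s i) (f' i) (h i)) => // i; exact: ml.
Qed.

(** Test [f] on [j x + k (a *: y)], with [a] scaling [y] to norm [t]: the value is at most
    [1 + e / 2 * t] but exceeds [1 - d + a * f (k y)]. The choice [d = e / 2 * t] balances the
    two. *)
Lemma norm_le_small_inl (e : R) :
  0 < e -> (exists2 t : R, 0 < t & N 1 t <= 1 + e / 2 * t) ->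
  exists2 d : R, 0 < d & forall (f : Z -> R^o) (x : X),
    dual_ball f -> `|x| <= 1 -> 1 - d < f (j x) -> forall y, f (k y) <= e * `|y|.
Proof.
move=> e0 [t t0 Nt]; exists (e / 2 * t) => [|f x fB x1 fx y].
  by rewrite mulr_gt0// divr_gt0.
have [->|y0] := eqVneq y 0.
  by rewrite linear0 (dual_ball_eval0 fB) normr0 mulr0.
have ny : 0 < `|y| by rewrite normr_gt0.
set a := t / `|y|; have a0 : 0 < a by rewrite divr_gt0.
have := dual_ball_le (j x + k (a *: y)) fB; rewrite norm_inlr.
rewrite (dual_ballD _ _ fB) linearZ (dual_ballZ _ _ fB) => le1.
have nay : `|a *: y| = t by rewrite normrZ gtr0_norm// divfK ?gt_eqF.
have N1 : N `|x| `|a *: y| <= N 1 t by rewrite nay (absolute_sum_homo S)// ltW.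
have aE : a * (e * `|y|) = e * t by rewrite mulrCA divfK ?gt_eqF.
by rewrite -(ler_pM2l a0) aE; lra.
Qed.

(* The hypothesis on [N] is its smoothness at [(1, 0)]. *)
Lemma small_inl (e : R) :
  (forall e : R, 0 < e -> exists2 t : R, 0 < t & N 1 t <= 1 + e * t) -> 0 < e ->
  exists2 d : R, 0 < d & forall (f g : Z -> R^o) (x : X),
    dual_ball f -> dual_ball g -> `|x| <= 1 ->
    1 - d < f (j x) -> 1 - d < g (j x) ->
    forall y : Y, f (k y) - g (k y) <= e * `|y|.
Proof.
move=> Ns e0; have e2 : 0 < e / 2 by rewrite divr_gt0.
have [d d0 H] := norm_le_small_inl e2 (Ns _ (divr_gt0 e2 (ltr0Sn _ 1))).
exists d => // f g x fB gB x1 fx gx y.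
(* The bound is one-sided, so [g] is tested at [- y]. *)
have := H f x fB x1 fx y; have := H g x gB x1 gx (- y).
by rewrite linearN (dual_ballN _ gB) normrN => *; lra.
Qed.

End absolute_sum_coordinate.

(** * Transfer of small sets between a sum and one coordinate *)

Section absolute_sum_roughness.
Context {R : realType} {X Y Z : normedModType R} {N : R -> R -> R}.
Context {j : {linear X -> Z}} {k : {linear Y -> Z}}.
Context {p : {linear Z -> X}} {q : {linear Z -> Y}}.
Hypothesis S : absolute_sum N j k p q.
Let S' := absolute_sum_sym S.

(** The dual of an l1-sum carries the max norm, so its ball is a product of balls. *)
Lemma dual_ball_glue_sum (g : X -> R^o) (h : Y -> R^o) :
  (forall a b, 0 <= a -> 0 <= b -> N a b = a + b) -> dual_ball g -> dual_ball h ->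
  dual_ball (glue (p := p) (q := q) 1 g h).
Proof.
move=> Nadd gB hB; apply/dual_ballP; split=> [|z].
  by apply: glue_linear; exact: dual_ball_linear.
by rewrite /glue mul1r (absolute_sum_norm S) Nadd// lerD// dual_ball_le.
Qed.

Lemma dual_ball_glue_conv (s t : R) (g : X -> R^o) (h : Y -> R^o) :
  0 <= s -> 0 <= t -> s + t <= 1 -> dual_ball g -> dual_ball h ->
  dual_ball (glue (p := p) (q := q) s g (fun y => t * h y)).
Proof.
move=> s0 t0 st gB hB; apply/dual_ballP; split=> [|z].
  apply: glue_linear; first exact: dual_ball_linear.
  move=> a x y; rewrite (dual_ballD _ _ hB) (dual_ballZ _ _ hB) mulrDr.
  by congr (_ + _); exact: mulrCA.
apply: (@le_trans _ _ (s * `|z| + t * `|z|)); last first.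
  by rewrite -mulrDl ler_piMl.
rewrite /glue lerD// ler_wpM2l//.
  by apply: le_trans (dual_ball_le _ gB) _; exact: (norm_projl S).
by apply: le_trans (dual_ball_le _ hB) _; exact: (norm_projl S').
Qed.

Lemma glue_inlr (f : Z -> R^o) s : dual_ball f -> 0 < s ->
  glue (p := p) (q := q) s (fun x => s^-1 * f (j x)) (f \o k) = f.
Proof.
move=> fB s0; apply/funext => z.
by rewrite /glue mulrA divff ?gt_eqF// mul1r (dual_ball_split S z fB).
Qed.

(** Section through a point [f] of the small set with [s = 1], so no constant is lost. *)
Lemma small_wcaps_sum1 P : (forall a b, 0 <= a -> 0 <= b -> N a b = a + b) ->
  @small_wcaps R Z P -> @small_wcaps R X P.
Proof.
move=> Nadd Zs e e0; have [l [Pl [f fl] lS]] := Zs _ e0.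
have fB := wcap_sub fl.
have [||l' [sl' l'0 l'S]] :=
    @small_wcap_section _ _ _ _ _ _ _ _ _ S 1 (f \o k) l e ltr01 _ _ lS.
- move=> g gB; apply: dual_ball_glue_sum => //.
  exact: (dual_ball_inl S').
- exists (f \o j); first exact: (dual_ball_inl S).
  by rewrite (_ : glue _ _ _ = f)//; apply/funext => z;
    rewrite /glue mul1r (dual_ball_split S z fB).
- by rewrite divr1 in l'S; exists l'; split=> //; rewrite sl'.
Qed.

Lemma small_slice_combs_sum1 : (forall a b, 0 <= a -> 0 <= b -> N a b = a + b) ->
  @small_slice_combs R Z -> @small_slice_combs R X.
Proof.
move=> Nadd Zs e e0; have [n [w [z [c [w0 w1 c0 zS]]]]] := Zs _ e0.
have /choice[f fz] : forall i, exists f, wcap [:: (z i, c i)] f by exact: c0.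
have m1 : \sum_(i < n) w i * 1 = 1.
  by rewrite -[RHS]w1; apply: eq_bigr => i _; rewrite mulr1.
have := @small_slice_comb_section _ _ _ _ _ _ _ _ _ S n w (fun=> 1) c z
  (fun i => f i \o k) e.
rewrite m1 divr1 => H; exists n; apply: H => //.
- move=> i g gB; apply: dual_ball_glue_sum => //.
  by apply: (dual_ball_inl S'); exact: wcap_sub (fz i).
- move=> i; have fB := wcap_sub (fz i).
  exists (f i \o j); first exact: (dual_ball_inl S).
  by rewrite (_ : glue _ _ _ = f i)//; apply/funext => y;
    rewrite /glue mul1r (dual_ball_split S y fB).
Qed.

(** Section with [s] the norm of [f \o j]; the factor [1 / s] is at most [2]. *)
Lemma small_wcap_inl (l : seq (Z * R)) (f : Z -> R^o) e :
  wcap l f -> small (wcap l) e -> 2^-1 <= dual_norm (f \o j) ->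
  exists l' : seq (X * R),
    [/\ size l' = size l, wcap l' !=set0 & small (wcap l') (2 * e)].
Proof.
move=> fl lS f2; have fB := wcap_sub fl; have fjB := dual_ball_inl S fB.
have s0 : 0 < dual_norm (f \o j) by apply: lt_le_trans f2; rewrite invr_gt0.
have [||l' [sl' l'0 l'S]] :=
    @small_wcap_section _ _ _ _ _ _ _ _ _ S _ (f \o k) l e s0 _ _ lS.
- by move=> g gB; exact: (dual_ball_glue_norm S).
- exists (fun x => (dual_norm (f \o j))^-1 * f (j x)).
    exact: (dual_ball_divZ fjB s0 (lexx _)).
  by rewrite glue_inlr.
exists l'; split=> // g h gl' hl' x; apply: le_trans (l'S _ _ gl' hl' x) _.
have [x0|x0] := eqVneq x 0; first by rewrite x0 normr0 !mulr0.
have nx : 0 < `|x| by rewrite normr_gt0.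
(* The sign of [e] is not assumed; comparing [f] with itself at a nonzero vector yields it. *)
have e0 : 0 <= e.
  have := lS f f fl fl (j x); rewrite subrr (norm_inl S) => H.
  by rewrite -(pmulr_lge0 _ nx).
rewrite ler_wpM2r// mulrC ler_wpM2r//.
by rewrite -[leRHS]invrK lef_pV2// posrE.
Qed.

(** Pulling the constraints back along [p] controls first coordinates, and the peak controls second
    ones. The number of constraints is unchanged, so slices yield slices. *)
Lemma small_wcaps_absolute_sum (P : pred nat) :
  (forall e : R, 0 < e -> exists2 t : R, 0 < t & N 1 t <= 1 + e * t) ->
  @peaked_small_wcaps R X P -> @small_wcaps R Z P.
Proof.
move=> Ns Xs e e0; have e2 : 0 < e / 2 by rewrite divr_gt0.
have [d d0 kS] := small_inl S Ns e2.
have [l [x [Pl x1 [g gl] lS lx]]] := Xs _ _ e2 d0.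
pose l' := [seq (j u.1, u.2) | u <- l].
have jl f : wcap l' f -> wcap l (f \o j).
  move=> fl'; have fjB := dual_ball_inl S (wcap_sub fl').
  exact: (wcap_map_sub fjB fl').
exists l'; split=> //; first by rewrite size_map.
  exists (g \o p); split; first exact: (dual_ball_projl S (wcap_sub gl)).
  move=> _ /mapP[u ul ->] /=; rewrite (absolute_sum_pj S).
  by case: gl => _; exact.
move=> f f' fl f'l z; have fB := wcap_sub fl; have f'B := wcap_sub f'l.
rewrite (dual_ball_split S _ fB) (dual_ball_split S _ f'B) opprD addrACA.
have := lS _ _ (jl _ fl) (jl _ f'l) (p z) => /= jS.
have := kS f f' x fB f'B x1 (lx _ (jl _ fl)) (lx _ (jl _ f'l)) (q z).
have : e / 2 * `|p z| <= e / 2 * `|z|.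
  by rewrite ler_wpM2l ?(ltW e2)//; exact: (norm_projl S).
have : e / 2 * `|q z| <= e / 2 * `|z|.
  by rewrite ler_wpM2l ?(ltW e2)//; exact: (norm_projl S').
by move=> *; lra.
Qed.

(** Each slice is replaced by a peaked subslice. The combination of first coordinates stays small
    because it lies in the original one, while second coordinates are small term by term. *)
Lemma small_slice_combs_absolute_sum : nontrivial X ->
  (forall e : R, 0 < e -> exists2 t : R, 0 < t & N 1 t <= 1 + e * t) ->
  @small_slice_combs R X -> @small_slice_combs R Z.
Proof.
move=> Xnt Ns Xs e e0; have e2 : 0 < e / 2 by rewrite divr_gt0.
have [d d0 kS] := small_inl S Ns e2.
have [n [w [z [c [w0 w1 c0 zS]]]]] := Xs _ e2.
have /choice[xc xcP] i : exists xc : X * R, [/\ `|xc.1| <= 1, 1 - d <= xc.2,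
    wcap [:: xc] !=set0 & wcap [:: xc] `<=` wcap [:: (z i, c i)]].
  have [x [a H]] := exists_peaked_slice Xnt (c0 i) d0.
  by exists (x, a).
have jl i (f : Z -> R^o) : wcap [:: (j (xc i).1, (xc i).2)] f ->
    wcap [:: xc i] (f \o j).
  move=> /wcap1P[fB fx]; have fjB := dual_ball_inl S fB.
  by rewrite [xc i]surjective_pairing; apply/wcap1P.
exists n, w, (fun i => j (xc i).1), (fun i => (xc i).2); split=> //.
  move=> i; have [_ _ [g] + _] := xcP i.
  rewrite [xc i]surjective_pairing => /wcap1P[gB gx].
  exists (g \o p); apply/wcap1P; split; first exact: (dual_ball_projl S gB).
  by rewrite /= (absolute_sum_pj S).
move=> _ _ [f fl <-] [f' f'l <-] v.
have fB i : dual_ball (f i) := wcap_sub (fl i).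
have f'B i : dual_ball (f' i) := wcap_sub (f'l i).
have sumE (F : 'I_n -> Z -> R^o) : (forall i, dual_ball (F i)) ->
    (\sum_(i < n) w i *: F i) v = (\sum_(i < n) w i *: (F i \o j)) (p v) +
      \sum_(i < n) w i * F i (k (q v)).
  move=> FB; rewrite !sum_funE -big_split; apply: eq_bigr => i _ /=.
  rewrite /GRing.scale/= /GRing.scale/= -mulrDr.
  by rewrite (dual_ball_split S _ (FB i)).
rewrite !sumE// opprD addrACA.
have jS : (\sum_(i < n) w i *: (f i \o j)) (p v) -
    (\sum_(i < n) w i *: (f' i \o j)) (p v) <= e / 2 * `|p v|.
  apply: zS.
    by exists (fun i => f i \o j) => // i; have [_ _ _] := xcP i; apply; exact: jl.
  by exists (fun i => f' i \o j) => // i; have [_ _ _] := xcP i; apply; exact: jl.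
have : \sum_(i < n) w i * f i (k (q v)) - \sum_(i < n) w i * f' i (k (q v)) <=
    e / 2 * `|q v|.
  have -> : e / 2 * `|q v| = \sum_(i < n) w i * (e / 2 * `|q v|).
    by rewrite -mulr_suml w1 mul1r.
  rewrite -sumrB; apply: ler_sum => i _.
  rewrite -mulrBr ler_wpM2l ?(ltW (w0 i))//.
  have [x1 dx _ _] := xcP i; have /wcap1P[_ fx] := fl i.
  have /wcap1P[_ f'x] := f'l i.
  by apply: (kS _ _ (xc i).1) => //; [exact: le_lt_trans fx|exact: le_lt_trans f'x].
have : e / 2 * `|p v| <= e / 2 * `|v|.
  by rewrite ler_wpM2l ?(ltW e2)//; exact: (norm_projl S).
have : e / 2 * `|q v| <= e / 2 * `|v|.
  by rewrite ler_wpM2l ?(ltW e2)//; exact: (norm_projl S').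
by move=> *; lra.
Qed.

(** [N 1 1 <= 1] is the max-norm case, whose dual norm is additive: [x] and [y] range over the unit
    balls independently. *)
Lemma dual_norm_inlD (f : Z -> R^o) : N 1 1 <= 1 -> dual_ball f ->
  dual_norm (f \o j) + dual_norm (f \o k) <= 1.
Proof.
move=> N1 fB; have fjB := dual_ball_inl S fB; have fkB := dual_ball_inl S' fB.
rewrite addrC -lerBrDr -[leLHS]mulr1; apply: dual_norm_mul_le => // y y1.
rewrite lerBrDl -lerBrDr -[leLHS]mulr1; apply: dual_norm_mul_le => // x x1.
rewrite lerBrDr /= -(dual_ballD _ _ fB); apply: le_trans (dual_ball_le _ fB) _.
rewrite (norm_inlr S); apply: le_trans _ N1.
by apply: (absolute_sum_homo S).
Qed.

(* Shrinking [f] slightly leaves room to make both weights positive. *)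
Lemma wcap_glue_conv l (f : Z -> R^o) : N 1 1 <= 1 -> wcap l f ->
  exists s t (g : X -> R^o) (h : Y -> R^o),
    [/\ 0 < s, 0 < t, s + t = 1 & dual_ball g /\ dual_ball h] /\
    wcap l (glue (p := p) (q := q) s g (fun y => t * h y)).
Proof.
move=> N1 fl; have fB := wcap_sub fl.
have fjB := dual_ball_inl S fB; have fkB := dual_ball_inl S' fB.
have fjk := dual_norm_inlD N1 fB.
have fj0 : 0 <= dual_norm (f \o j) by apply: dual_norm_ge0; case: fjB.
have fk0 : 0 <= dual_norm (f \o k) by apply: dual_norm_ge0; case: fkB.
have [r [r0 r1 fr]] : exists r : R, [/\ 0 < r, r < 1 &
    forall u, u \in l -> u.2 < (1 - r) * f u.1].
  case: fl => _; elim: l => [_|u l IHl fl].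
    by exists 2^-1; split; rewrite ?invr_gt0 ?invf_lt1 ?ltr1n.
  have [v vl|r [r0 r1 fr]] := IHl; first by apply: fl; rewrite inE vl orbT.
  have := fl u; rewrite inE eqxx => /(_ isT) fu.
  (* Shrinking does not decrease a nonpositive value, so only positive values restrict [r]. *)
  have [f0|f0] := leP (f u.1) 0.
    exists r; split=> // v; rewrite inE => /orP[/eqP ->|]; last exact: fr.
    apply: lt_le_trans fu _; rewrite mulrBl mul1r lerDl oppr_ge0.
    by rewrite mulr_ge0_le0// ltW.
  (* Chosen so that at most half of the gap [f u.1 - u.2] is lost. *)
  pose a := Num.min r ((f u.1 - u.2) / (2 * f u.1)).
  have a0 : 0 < a by rewrite lt_min r0 divr_gt0 ?mulr_gt0// subr_gt0.
  exists a; split=> //; first by rewrite gt_min r1.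
  move=> v; rewrite inE => /orP[/eqP ->|vl].
    have : a * f u.1 <= (f u.1 - u.2) / 2.
      rewrite -ler_pdivlMr// -mulrA -invfM ge_min.
      by rewrite lexx orbT.
    by move=> af; rewrite mulrBl mul1r; lra.
  have := fr v vl; have [fv|fv] := leP 0 (f v.1).
    move=> /lt_le_trans; apply; rewrite ler_wpM2r// lerD2l lerN2 ge_min lexx//.
  move=> _; have := fl v; rewrite inE vl orbT => /(_ isT) vf.
  apply: lt_le_trans vf _; rewrite mulrBl mul1r lerDl oppr_ge0.
  by rewrite mulr_ge0_le0// ltW.
(* The norms of the coordinates of [(1 - r) f] add up to at most [1 - r]; the slack [r] is split so
   that each weight exceeds its norm by at least [r / 2]. *)
pose t := (1 - r) * dual_norm (f \o k) + r / 2; pose s := 1 - t.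
have rk : 0 <= (1 - r) * dual_norm (f \o k) by rewrite mulr_ge0// subr_ge0 ltW.
have rj : 0 <= (1 - r) * dual_norm (f \o j) by rewrite mulr_ge0// subr_ge0 ltW.
have rjk : (1 - r) * (dual_norm (f \o j) + dual_norm (f \o k)) <= 1 - r.
  by rewrite ler_piMr// subr_ge0 ltW.
have t0 : 0 < t by rewrite /t; lra.
have s0 : 0 < s by rewrite /s /t; lra.
have r10 : 0 < 1 - r by rewrite subr_gt0.
have scB (T : normedModType R) (g : T -> R^o) (a : R) : dual_ball g -> 0 < a ->
    (1 - r) * dual_norm g <= a -> dual_ball (fun x => (a / (1 - r))^-1 * g x : R^o).
  move=> gB a0 ga; apply: dual_ball_divZ; rewrite ?divr_gt0//.
  by rewrite ler_pdivlMr// mulrC.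
exists s, t, (fun x => (s / (1 - r))^-1 * f (j x)),
  (fun y => (t / (1 - r))^-1 * f (k y)).
have jB : dual_ball (fun x => (s / (1 - r))^-1 * f (j x) : R^o).
  by apply: (scB _ _ _ fjB) => //; rewrite /s /t; lra.
have kB : dual_ball (fun y => (t / (1 - r))^-1 * f (k y) : R^o).
  by apply: (scB _ _ _ fkB) => //; rewrite /t; lra.
split; first by split=> //; rewrite /s; lra.
split; first by apply: (dual_ball_glue_conv (ltW s0) (ltW t0)) => //; rewrite /s; lra.
move=> u ul; apply: lt_le_trans (fr _ ul) _.
rewrite (dual_ball_split S _ fB) /glue !invfM !invrK !mulrA !divff ?gt_eqF//.
by rewrite !mul1r mulrDr.
Qed.

Lemma small_slice_comb_inl n (w s t c : 'I_n -> R) (z : 'I_n -> Z)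
    (g : 'I_n -> X -> R^o) (h : 'I_n -> Y -> R^o) e :
  (forall i, 0 < w i) -> small (slice_comb w z c) e -> 0 <= e ->
  (forall i, [/\ 0 < s i, 0 < t i, s i + t i = 1
    & dual_ball (g i) /\ dual_ball (h i)]) ->
  (forall i, wcap [:: (z i, c i)]
    (glue (p := p) (q := q) (s i) (g i) (fun y => t i * h i y))) ->
  2^-1 <= \sum_(i < n) w i * s i ->
  exists (w' : 'I_n -> R) (x : 'I_n -> X) (c' : 'I_n -> R),
    [/\ forall i, 0 < w' i, \sum_(i < n) w' i = 1,
      forall i, wcap [:: (x i, c' i)] !=set0 &
      small (slice_comb w' x c') (2 * e)].
Proof.
move=> w0 zS e0 st gh m2.
have m0 : 0 < \sum_(i < n) w i * s i by apply: lt_le_trans m2; rewrite invr_gt0.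
have [|||w' [x [c' [w'0 w'1 c'0 S0]]]] :=
  @small_slice_comb_section _ _ _ _ _ _ _ _ _ S n w s c z
    (fun i y => t i * h i y) e m0 w0 _ _ _ zS.
- by move=> i; case: (st i).
- move=> i g' g'B; have [s0 t0 st1 [_ hB]] := st i.
  by apply: (dual_ball_glue_conv (ltW s0) (ltW t0)) => //; rewrite st1.
- by move=> i; exists (g i); [have [_ _ _ []] := st i|exact: gh].
exists w', x, c'; split=> //; apply: small_le S0.
by rewrite mulrC ler_wpM2r// -[leRHS]invrK lef_pV2// posrE.
Qed.

End absolute_sum_roughness.

(** * Statements involving both coordinates *)

Section absolute_sum_both_coordinates.
Context {R : realType} {X Y Z : normedModType R} {N : R -> R -> R}.
Context {j : {linear X -> Z}} {k : {linear Y -> Z}}.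
Context {p : {linear Z -> X}} {q : {linear Z -> Y}}.
Hypothesis S : absolute_sum N j k p q.
Let S' := absolute_sum_sym S.

(** Which coordinate inherits smallness may depend on [e], so one argues by contradiction with a
    single [e] for two failing thresholds; halving their minimum absorbs the factor [2] of the
    section. *)
Lemma small_wcaps_or P :
  @small_wcaps R Z P -> @small_wcaps R X P \/ @small_wcaps R Y P.
Proof.
move=> Zs; apply: contrapT => /not_orP[/existsNP[e1 /not_implyP[e10 Xe1]]].
move=> /existsNP[e2 /not_implyP[e20 Ye2]].
have e0 : 0 < Num.min e1 e2 / 2 by rewrite divr_gt0// lt_min e10.
have [l [Pl [f fl] lS]] := Zs _ e0; have fB := wcap_sub fl.
have le1 : 2 * (Num.min e1 e2 / 2) <= e1 by rewrite mulrC divfK// ge_min lexx.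
have le2 : 2 * (Num.min e1 e2 / 2) <= e2 by rewrite mulrC divfK// ge_min lexx orbT.
have [fj|fj] := leP 2^-1 (dual_norm (f \o j)).
  have [l' [sl l0 l'S]] := small_wcap_inl S fl lS fj.
  by apply: Xe1; exists l'; rewrite sl; split=> //; exact: small_le l'S.
have [fk|fk] := leP 2^-1 (dual_norm (f \o k)).
  have [l' [sl l0 l'S]] := small_wcap_inl S' fl lS fk.
  by apply: Ye2; exists l'; rewrite sl; split=> //; exact: small_le l'S.
(* Both restrictions now have norm below [1/2]: with weights [1/2] and [1/2] any [g] in the ball may
   serve as first coordinate, so [s = 1/2] works. *)
have h0 : 0 < 2^-1 :> R by rewrite invr_gt0.
have fjB := dual_ball_inl S fB; have fkB := dual_ball_inl S' fB.
have [||l' [sl l0 l'S]] :=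
    @small_wcap_section _ _ _ _ _ _ _ _ _ S _ (f \o k) l _ h0 _ _ lS.
- move=> g gB; have kB := dual_ball_divZ fkB h0 (ltW fk).
  have := dual_ball_glue_conv S (ltW h0) (ltW h0) _ gB kB.
  rewrite (_ : (fun y => _) = f \o k); last first.
    by apply/funext => y; rewrite mulrA divff ?gt_eqF// mul1r.
  by apply; lra.
- exists (fun x => (2^-1)^-1 * f (j x)).
    exact: (dual_ball_divZ fjB h0 (ltW fj)).
  by rewrite (glue_inlr S fB h0).
apply: Xe1; exists l'; rewrite sl; split=> //; apply: small_le l'S.
by rewrite invrK mulrC.
Qed.

(** Each slice contains a point with coordinate weights adding up to [1], so the two averages of
    these weights add up to [1] and one of them is at least [1/2]. *)
Lemma small_slice_combs_or : N 1 1 <= 1 ->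
  @small_slice_combs R Z -> @small_slice_combs R X \/ @small_slice_combs R Y.
Proof.
move=> N1 Zs; apply: contrapT => /not_orP[/existsNP[e1 /not_implyP[e10 Xe1]]].
move=> /existsNP[e2 /not_implyP[e20 Ye2]].
have e0 : 0 < Num.min e1 e2 / 2 by rewrite divr_gt0// lt_min e10.
have [n [w [z [c [w0 w1 c0 zS]]]]] := Zs _ e0.
have le1 : 2 * (Num.min e1 e2 / 2) <= e1 by rewrite mulrC divfK// ge_min lexx.
have le2 : 2 * (Num.min e1 e2 / 2) <= e2 by rewrite mulrC divfK// ge_min lexx orbT.
have /choice[a aP] i : exists a : (R * R) * ((X -> R^o) * (Y -> R^o)),
    [/\ 0 < a.1.1, 0 < a.1.2, a.1.1 + a.1.2 = 1 & dual_ball a.2.1 /\ dual_ball a.2.2] /\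
    wcap [:: (z i, c i)]
      (glue (p := p) (q := q) a.1.1 a.2.1 (fun y => a.1.2 * a.2.2 y)).
  have [f fl] := c0 i; have [s [t [g [h H]]]] := wcap_glue_conv S N1 fl.
  by exists ((s, t), (g, h)).
have wst : \sum_(i < n) w i * (a i).1.1 + \sum_(i < n) w i * (a i).1.2 = 1.
  rewrite -big_split -[RHS]w1; apply: eq_bigr => i _ /=.
  by have [[_ _ st _] _] := aP i; rewrite -mulrDr st mulr1.
have [ws|ws] := leP 2^-1 (\sum_(i < n) w i * (a i).1.1).
  have [i|i|w' [x [c' [w'0 w'1 c'0 xS]]]] := @small_slice_comb_inl
    _ _ _ _ _ _ _ _ _ S n w (fun i => (a i).1.1) (fun i => (a i).1.2) c z
    (fun i => (a i).2.1) (fun i => (a i).2.2) _ w0 zS (ltW e0) _ _ ws.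
    by have [] := aP i.
    by have [] := aP i.
  by apply: Xe1; exists n, w', x, c'; split=> //; exact: small_le xS.
have wt : 2^-1 <= \sum_(i < n) w i * (a i).1.2 by lra.
have [i|i|w' [y [c' [w'0 w'1 c'0 yS]]]] := @small_slice_comb_inl
  _ _ _ _ _ _ _ _ _ S' n w (fun i => (a i).1.2) (fun i => (a i).1.1) c z
  (fun i => (a i).2.2) (fun i => (a i).2.1) _ w0 zS (ltW e0) _ _ wt.
- by have [[? ? st [? ?]] _] := aP i; split; rewrite // addrC.
- have [_] := aP i; rewrite (_ : glue _ _ _ =
    glue (p := q) (q := p) (a i).1.2 (a i).2.2 (fun x => (a i).1.1 * (a i).2.1 x))//.
  by apply/funext => v; rewrite /glue addrC.
by apply: Ye2; exists n, w', y, c'; split=> //; exact: small_le yS.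
Qed.

(** Imposing both lists of constraints keeps the constant [e], since the norm of [z] is the sum of
    those of its coordinates. *)
Lemma small_wcaps_sum1_and : (forall a b, 0 <= a -> 0 <= b -> N a b = a + b) ->
  @small_wcaps R X predT -> @small_wcaps R Y predT -> @small_wcaps R Z predT.
Proof.
move=> Nadd Xs Ys e e0.
have [l [_ [g gl] lS]] := Xs _ e0; have [m [_ [h hm] mS]] := Ys _ e0.
have gB := wcap_sub gl; have hB := wcap_sub hm.
exists ([seq (j u.1, u.2) | u <- l] ++ [seq (k u.1, u.2) | u <- m]); split=> //.
  exists (glue (p := p) (q := q) 1 g h); split; first exact: (dual_ball_glue_sum S).
  move=> u; rewrite mem_cat => /orP[] /mapP[v vl ->] /=; rewrite /glue mul1r.
    rewrite (absolute_sum_pj S) (absolute_sum_qj S) (dual_ball_eval0 hB) addr0.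
    by case: gl => _; exact.
  rewrite (absolute_sum_pk S) (absolute_sum_qk S) (dual_ball_eval0 gB) add0r.
  by case: hm => _; exact.
have jk f : wcap ([seq (j u.1, u.2) | u <- l] ++ [seq (k u.1, u.2) | u <- m]) f ->
    wcap l (f \o j) /\ wcap m (f \o k).
  move=> [fB fl]; split.
    split=> [|u ul]; first exact: (dual_ball_inl S).
    by apply: (fl (j u.1, u.2)); rewrite mem_cat (map_f (fun u => (j u.1, u.2))).
  split=> [|u ul]; first exact: (dual_ball_inl S').
  by apply: (fl (k u.1, u.2)); rewrite mem_cat (map_f (fun u => (k u.1, u.2)))// orbT.
move=> f f' fl f'l z; have [fj fk] := jk _ fl; have [f'j f'k] := jk _ f'l.
rewrite (dual_ball_split S z (wcap_sub fl)) (dual_ball_split S z (wcap_sub f'l)).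
rewrite opprD addrACA (absolute_sum_norm S) Nadd// mulrDr.
by apply: lerD; [exact: lS fj f'j _|exact: mS fk f'k _].
Qed.

(** One vector has to control both coordinates. As [f (k y)] is at most the norm of [y], the level
    forces [c < f (j x)], and symmetrically for [d]; gluing functionals that norm [x] and [y] shows
    the slice nonempty. *)
Lemma small_slices_sum1_and : (forall a b, 0 <= a -> 0 <= b -> N a b = a + b) ->
  @small_wcaps R X (pred1 1%N) -> @small_wcaps R Y (pred1 1%N) ->
  @small_wcaps R Z (pred1 1%N).
Proof.
move=> Nadd Xs Ys e e0.
have [l [/eqP + l0 lS]] := Xs _ e0; have [m [/eqP + m0 mS]] := Ys _ e0.
case: m m0 mS => [|[y d] [|//]] //= [h /wcap1P[hB hy]] mS _.
case: l l0 lS => [|[x c] [|//]] //= [g /wcap1P[gB gx]] lS _.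
have [g' g'B g'x] := exists_dual_ball_norm x.
have [h' h'B h'y] := exists_dual_ball_norm y.
have gle := dual_ball_le x gB; have hle := dual_ball_le y hB.
have jk f : dual_ball f -> f (j x + k y) = f (j x) + f (k y).
  by move=> fB; rewrite dual_ballD.
exists [:: (j x + k y, Num.max (c + `|y|) (d + `|x|))]; split=> //.
  exists (glue (p := p) (q := q) 1 g' h'); apply/wcap1P.
  have B : dual_ball (glue (p := p) (q := q) 1 g' h') by exact: (dual_ball_glue_sum S).
  split=> //; rewrite /glue mul1r !linearD (absolute_sum_pj S).
  rewrite (absolute_sum_pk S) (absolute_sum_qj S) (absolute_sum_qk S).
  rewrite addr0 add0r g'x h'y gt_max.
  by apply/andP; split; lra.
have jkS f : wcap [:: (j x + k y, Num.max (c + `|y|) (d + `|x|))] f ->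
    wcap [:: (x, c)] (f \o j) /\ wcap [:: (y, d)] (f \o k).
  move=> /wcap1P[fB]; rewrite jk// gt_max => /andP[fx fy].
  have fjB := dual_ball_inl S fB; have fkB := dual_ball_inl S' fB.
  have := dual_ball_le x fjB; have := dual_ball_le y fkB => /= fky fjx.
  by split; apply/wcap1P; split=> //=; lra.
move=> f f' fl f'l z; have [fj fk] := jkS _ fl; have [f'j f'k] := jkS _ f'l.
rewrite (dual_ball_split S z (wcap_sub fl)) (dual_ball_split S z (wcap_sub f'l)).
rewrite opprD addrACA (absolute_sum_norm S) Nadd// mulrDr.
by apply: lerD; [exact: lS fj f'j _|exact: mS fk f'k _].
Qed.

End absolute_sum_both_coordinates.

(** * The p-sums as absolute sums *)

Section psum_absolute_sum.
Context {R : realType} (p : \bar R) (p1 : (1 <= p)%E) (X Y : normedModType R).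

Definition pnorm2 (a b : R) : R :=
  match p with
  | r%:E => (a `^ r + b `^ r) `^ r^-1
  | +oo%E => Num.max a b
  | -oo%E => 0
  end.

Definition psum_inl (x : X) : psum p1 X Y := (x, 0).
Definition psum_inr (y : Y) : psum p1 X Y := (0, y).
Definition psum_projl (u : psum p1 X Y) : X := u.1.
Definition psum_projr (u : psum p1 X Y) : Y := u.2.

Let psum_inl_linear : linear psum_inl.
Proof.
move=> a x y.
(* The module structure of [psum] is copied from the product, so the goal converts to one in
   [X * Y], where the zero laws can be rewritten. *)
suff : (a *: x + y, 0) = (a *: x + y, a *: 0 + 0) :> X * Y by [].
by rewrite scaler0 addr0.
Qed.

Let psum_inr_linear : linear psum_inr.
Proof.
move=> a x y.
suff : (0, a *: x + y) = (a *: 0 + 0, a *: x + y) :> X * Y by [].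
by rewrite scaler0 addr0.
Qed.

Let psum_projl_linear : linear psum_projl. Proof. by []. Qed.
Let psum_projr_linear : linear psum_projr. Proof. by []. Qed.

HB.instance Definition _ :=
  GRing.isLinear.Build R X (psum p1 X Y) _ psum_inl psum_inl_linear.
HB.instance Definition _ :=
  GRing.isLinear.Build R Y (psum p1 X Y) _ psum_inr psum_inr_linear.
HB.instance Definition _ :=
  GRing.isLinear.Build R (psum p1 X Y) X _ psum_projl psum_projl_linear.
HB.instance Definition _ :=
  GRing.isLinear.Build R (psum p1 X Y) Y _ psum_projr psum_projr_linear.

Lemma psum_absolute_sum :
  absolute_sum pnorm2 psum_inl psum_inr psum_projl psum_projr.
Proof.
split=> //.
- move=> [x y]; suff : (x + 0, 0 + y) = (x, y) :> X * Y by [].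
  by rewrite addr0 add0r.
- rewrite /pnorm2; case: p p1 => [r|//|//]; rewrite ?lee_fin => r1 a b c d a0 b0 ac bd.
    exact: pnorm2_homo.
  by rewrite ge_max !le_max ac bd orbT.
- by rewrite /pnorm2 => a b; case: p => [r||//]; [rewrite addrC|rewrite maxC].
- rewrite /pnorm2 => a a0; case: p p1 => [r|_|//]; last exact: max_l.
  rewrite lee_fin => r1; have r0 : 0 < r by apply: lt_le_trans r1.
  by rewrite powR0 ?gt_eqF// addr0 -powRrM mulfV ?gt_eqF// powRr1.
Qed.

End psum_absolute_sum.

Lemma pnorm2_1 {R : realType} (a b : R) :
  0 <= a -> 0 <= b -> pnorm2 1%E a b = a + b.
Proof. by move=> a0 b0; rewrite /pnorm2 invr1 !powRr1// addr_ge0. Qed.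

(** For finite [r], the value [t = e ^ (1 / (r - 1))] solves [t ^ r = e * t], and the [r]-th root of
    a number at least [1] does not exceed it. For the max norm [t = 1] works. *)
Lemma pnorm2_smooth {R : realType} (p : \bar R) : (1 < p)%E ->
  forall e : R, 0 < e -> exists2 t : R, 0 < t & pnorm2 p 1 t <= 1 + e * t.
Proof.
rewrite /pnorm2; case: p => [r|_|//] => [|e e0]; last first.
  by exists 1 => //; rewrite maxxx mulr1 lerDl ltW.
rewrite lte_fin => r1 e e0; exists (e `^ (r - 1)^-1); first exact: powR_gt0.
set t := e `^ _; have t0 : 0 < t by exact: powR_gt0.
have tr : t `^ r = e * t.
  rewrite -[r](subrK 1) powRD; last by rewrite (gt_eqF t0) implybT.
  by rewrite powRr1 ?ltW// -powRrM mulVf ?powRr1 ?ltW// gt_eqF// subr_gt0.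
have base1 : 1 <= 1 + e * t by rewrite lerDl mulr_ge0 ?ltW.
rewrite powR1 tr -[leRHS]powRr1 ?(le_trans ler01)//.
by rewrite ler_powR// invf_le1 ?(lt_trans ltr01)// ltW.
Qed.

(** Nontriviality excludes the zero space: its dual ball has diameter [0], so it is non rough in
    every sense, while its sum with [Y] is isometric to [Y], which may be rough. *)
Theorem proposition2p5 (R : realType) (X Y : completeNormedModType R) :
  (* (1) *)
  ((weakly_average_non_rough (psum (lexx 1%E) X Y) <->
      weakly_average_non_rough X /\ weakly_average_non_rough Y) /\
   (non_rough (psum (lexx 1%E) X Y) <-> non_rough X /\ non_rough Y)) /\
  (* (2) *)
  (nontrivial X -> nontrivial Y ->
   forall (p : \bar R) (p1 : (1 < p)%E),
   (weakly_average_non_rough (psum (ltW p1) X Y) <->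
      weakly_average_non_rough X \/ weakly_average_non_rough Y) /\
   (non_rough (psum (ltW p1) X Y) <-> non_rough X \/ non_rough Y)) /\
  (* (3) *)
  (average_non_rough (psum (lexx 1%E) X Y) ->
     average_non_rough X /\ average_non_rough Y) /\
  (* (4) *)
  (nontrivial X -> nontrivial Y ->
   average_non_rough X \/ average_non_rough Y ->
   forall (p : \bar R) (p1 : (1 < p)%E),
     average_non_rough (psum (ltW p1) X Y)) /\
  (* (5) *)
  (nontrivial X -> nontrivial Y ->
   (average_non_rough (psum (leey 1%E) X Y) <->
      average_non_rough X \/ average_non_rough Y)).
Proof.
have S p p1 := @psum_absolute_sum R p p1 X Y.
have S' p p1 := absolute_sum_sym (S p p1).
(* Stated for any proof of [1 <= p], so that it fits both [ltW p1] in (4) and [leey] in (5). *)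
have avg (p : \bar R) (p1 : (1 <= p)%E) : (1 < p)%E -> nontrivial X -> nontrivial Y ->
    average_non_rough X \/ average_non_rough Y ->
    average_non_rough (psum p1 X Y).
  move=> /pnorm2_smooth sm Xnt Ynt; rewrite !average_non_roughP => -[].
    exact: (small_slice_combs_absolute_sum (S p p1)).
  exact: (small_slice_combs_absolute_sum (S' p p1)).
split; [|split; [|split; [|split]]].
- rewrite !weakly_average_non_roughP !non_roughP.
  split; split.
  + by move=> Zs; split; [apply: (small_wcaps_sum1 (S _ _) pnorm2_1) Zs|
      apply: (small_wcaps_sum1 (S' _ _) pnorm2_1) Zs].
  + by move=> [Xs Ys]; exact: (small_wcaps_sum1_and (S _ _) pnorm2_1).
  + by move=> Zs; split; [apply: (small_wcaps_sum1 (S _ _) pnorm2_1) Zs|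
      apply: (small_wcaps_sum1 (S' _ _) pnorm2_1) Zs].
  + by move=> [Xs Ys]; exact: (small_slices_sum1_and (S _ _) pnorm2_1).
- move=> Xnt Ynt p p1; rewrite !weakly_average_non_roughP !non_roughP.
  have sm := pnorm2_smooth p1.
  split; split; try exact: (small_wcaps_or (S p (ltW p1))).
  + case=> [/(peaked_wcaps Xnt)|/(peaked_wcaps Ynt)].
      exact: (small_wcaps_absolute_sum (S p (ltW p1))).
    exact: (small_wcaps_absolute_sum (S' p (ltW p1))).
  + case=> [/(peaked_slices Xnt)|/(peaked_slices Ynt)].
      exact: (small_wcaps_absolute_sum (S p (ltW p1))).
    exact: (small_wcaps_absolute_sum (S' p (ltW p1))).
- rewrite !average_non_roughP => Zs; split.
    by apply: (small_slice_combs_sum1 (S _ _) pnorm2_1) Zs.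
  by apply: (small_slice_combs_sum1 (S' _ _) pnorm2_1) Zs.
- by move=> Xnt Ynt XY p p1; exact: avg.
- move=> Xnt Ynt; split; last by apply: avg => //; rewrite ltry.
  rewrite !average_non_roughP; apply: (small_slice_combs_or (S _ _)).
  by rewrite /pnorm2 maxxx.
Qed.
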